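(* Let $p$ be a prime number and let $n\geq 3$, $m\geq 4$ be integers. Suppose that $G(p^n)=\langle a,x \mid x^p=a^{p^{n-1}}=1,\ a^x=a^{1+p^{n-2}}\rangle$, $H=\langle a,x\mid x^2=a^{2^{m-1}}=1,\ a^x=a^{2^{m-2}-1}\rangle$ and $K(p^n)=\mathbb{Z}_{p^{n-1}}\oplus\mathbb{Z}_p$. (1) If $S$ is a group such that $\Gamma_S\cong\Gamma_{K(8)}$, then $S\cong K(8)$. (2) If either $n>3$ or $p>2$, then $\Gamma_{G(p^n)}\cong\Gamma_{K(p^n)}$. (3) If $S$ is a group such that $\Gamma_S\cong\Gamma_H$, then $S\cong H$. (4) If $S$ is a group such that $\Gamma_S\cong\Gamma_{D_{2^n}}$, then $S\cong D_{2^n}$. (5) Let $S$ be a group. Then $\Gamma_S\cong\Gamma_{K(p^n)}$ if and only if $S\cong G(p^n)$ or $S\cong K(p^n)$.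
   Context: A group is locally cyclic if each of its finitely generated subgroups is cyclic. For a group $G$, $Cyc(G)=\{x\in G : \langle x,y\rangle \text{ is cyclic for all } y\in G\}$. For a non locally cyclic group $G$, the non-cyclic graph $\Gamma_G$ is the simple graph with vertex set $G\setminus Cyc(G)$ in which two distinct vertices $x,y$ are adjacent if and only if $\langle x,y\rangle$ is not cyclic. For non locally cyclic groups $S$ and $L$, $\Gamma_S\cong\Gamma_L$ means that the two graphs are isomorphic ($S$ is not assumed finite). Here $a^x=x^{-1}ax$; $\mathbb{Z}_k$ is the cyclic group of order $k$; $K(8)$ is the group $K(p^n)$ with $p=2$, $n=3$, that is, $\mathbb{Z}_4\oplus\mathbb{Z}_2$; $D_{2^n}$ is the dihedral group of order $2^n$.
   Formalization: Part (5) is stated only under the assumption of (2), ''n>3 or p>2'': for p=2, n=3 one has G(8)=D_8, so (5) as written would contradict (1); in that case (1) gives what remains true. *)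

(* Defs.v *)
From HB Require Import structures.
From mathcomp Require Import all_boot all_order all_algebra all_fingroup all_solvable.
From mathcomp Require Import boolp classical_sets cardinality.

Set Implicit Arguments.
Unset Strict Implicit.
Unset Printing Implicit Defensive.

Local Open Scope group_scope.
Local Open Scope classical_set_scope.

Definition isomorphic_groups (S L : groupType) : Prop :=
  exists f : {multiplicative S -> L}, bijective f.

Section CyclicSubgroups.
Variable G : groupType.

Definition is_subgroup (H : set G) : Prop :=
  H 1 /\ forall x y, H x -> H y -> H (x * y^-1).

Definition generated_subgroup (A : set G) : set G := smallest is_subgroup A.

Definition is_cyclic (H : set G) : Prop :=
  exists g : G, H = generated_subgroup [set g].

Definition locally_cyclic : Prop :=
  forall A : set G, finite_set A -> is_cyclic (generated_subgroup A).

Definition Cyc : set G :=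
  [set x | forall y, is_cyclic (generated_subgroup [set x; y])].

End CyclicSubgroups.

Arguments Cyc : clear implicits.

Record simple_graph := SimpleGraph {
  vertex :> Type;
  adj : vertex -> vertex -> Prop;
  adj_sym : forall u v, adj u v -> adj v u;
  adj_irrefl : forall u, ~ adj u u }.

Definition isomorphic_graphs (X Y : simple_graph) : Prop :=
  exists f : X -> Y, bijective f /\ forall u v, adj (f u) (f v) <-> adj u v.

Section NonCyclicGraph.
Variable G : groupType.

(* The vertex type is the subtype of G given by the complement of Cyc G. *)
Definition noncyclic_adj (u v : ~` Cyc G) : Prop :=
  u <> v /\ ~ is_cyclic (generated_subgroup [set val u; val v]).

Lemma noncyclic_adj_sym u v : noncyclic_adj u v -> noncyclic_adj v u.
Proof. by case=> uv nuv; split; [move=> vu; apply: uv | rewrite setUC]. Qed.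

Lemma noncyclic_adj_irrefl u : ~ noncyclic_adj u u.
Proof. by case. Qed.

Definition noncyclic_graph : simple_graph :=
  SimpleGraph noncyclic_adj_sym noncyclic_adj_irrefl.

End NonCyclicGraph.

(* The non-cyclic graph is only considered for groups that are not locally
   cyclic, so this is part of what it means to compare two such graphs. *)
Definition isomorphic_noncyclic_graphs (S L : groupType) : Prop :=
  [/\ ~ locally_cyclic S, ~ locally_cyclic L
    & isomorphic_graphs (noncyclic_graph S) (noncyclic_graph L)].

(* Groups given by generators and relations. A word over the generators I is a
   sequence of letters (i, false) and (i, true), standing for i and i^-1; a
   relation u = v is a pair of words. *)
Section Presentation.
Variable I : choiceType.

Definition word := seq (I * bool).

Definition word_gen (i : I) : word := [:: (i, false)].
Definition word_inv (w : word) : word := rev [seq (l.1, ~~ l.2) | l <- w].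
Definition word_exp (w : word) (k : nat) : word := flatten (nseq k w).
Definition word_conj (u w : word) : word := word_inv w ++ u ++ w.

Variable rels : seq (word * word).

Inductive word_eq : word -> word -> Prop :=
| word_eq_refl u : word_eq u u
| word_eq_sym u v : word_eq u v -> word_eq v u
| word_eq_trans u v w : word_eq u v -> word_eq v w -> word_eq u w
| word_eq_cat u u' v v' :
    word_eq u u' -> word_eq v v' -> word_eq (u ++ v) (u' ++ v')
| word_eq_cancel i b : word_eq [:: (i, b); (i, ~~ b)] [::]
| word_eq_rel r : r \in rels -> word_eq r.1 r.2.

Definition word_eqb (u v : word) : bool := `[< word_eq u v >].

Lemma word_eqb_equiv : equiv_class_of word_eqb.
Proof.
split=> [u|u v|v u w].
- exact/asboolP/word_eq_refl.
- by apply/asboolP/asboolP; apply: word_eq_sym.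
- by move=> /asboolP uv /asboolP vw; apply/asboolP/(word_eq_trans uv vw).
Qed.

Canonical word_equiv := EquivRelPack word_eqb_equiv.

Definition presented_group := {eq_quot word_equiv}%qT.

HB.instance Definition _ := Choice.on presented_group.
HB.instance Definition _ := EqQuotient.on presented_group.

Definition pres (w : word) : presented_group := (\pi_presented_group w)%qT.

Lemma presP (u v : word) : pres u = pres v <-> word_eq u v.
Proof.
split=> [/eqmodP /asboolP //|uv].
by apply/eqmodP/asboolP.
Qed.

Lemma pres_repr (x : presented_group) : pres (generic_quotient.repr x) = x.
Proof. exact: reprK. Qed.

Lemma word_invK : involutive word_inv.
Proof.
move=> w; rewrite /word_inv map_rev revK -map_comp map_id_in // => -[i b] _ /=.
by rewrite negbK.
Qed.

Lemma word_eq_invr w : word_eq (w ++ word_inv w) [::].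
Proof.
elim: w => [|[i b] w IHw]; first exact: word_eq_refl.
rewrite /word_inv /= rev_cons -cats1 -/(word_inv w).
apply: word_eq_trans (word_eq_cancel i b).
rewrite -(cat1s (i, b) (w ++ _)) -(cat1s (i, b) [:: _]).
apply: word_eq_cat (word_eq_refl _) _.
rewrite catA -[X in word_eq _ X]cat0s.
exact: word_eq_cat (word_eq_refl _).
Qed.

Lemma word_eq_invl w : word_eq (word_inv w ++ w) [::].
Proof. by rewrite -{2}(word_invK w); apply: word_eq_invr. Qed.

Lemma word_eq_inv u v : word_eq u v -> word_eq (word_inv u) (word_inv v).
Proof.
move=> uv; apply: (@word_eq_trans _ (word_inv u ++ v ++ word_inv v)).
  rewrite -[X in word_eq X _]cats0; apply: word_eq_cat (word_eq_refl _) _.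
  exact: word_eq_sym (word_eq_invr v).
rewrite catA -[X in word_eq _ X]cat0s.
apply: word_eq_cat (word_eq_refl _).
apply: word_eq_trans (word_eq_invl u).
exact: word_eq_cat (word_eq_refl _) (word_eq_sym uv).
Qed.

Definition pres_one : presented_group := pres [::].
Definition pres_mul (x y : presented_group) : presented_group :=
  pres (generic_quotient.repr x ++ generic_quotient.repr y).
Definition pres_inv (x : presented_group) : presented_group :=
  pres (word_inv (generic_quotient.repr x)).

Lemma pres_mulE u v : pres_mul (pres u) (pres v) = pres (u ++ v).
Proof. by apply/presP; apply: word_eq_cat; apply/presP; rewrite pres_repr. Qed.

Lemma pres_invE u : pres_inv (pres u) = pres (word_inv u).
Proof. by apply/presP; apply: word_eq_inv; apply/presP; rewrite pres_repr. Qed.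

Lemma pres_mulA : associative pres_mul.
Proof.
move=> x y z; rewrite -(pres_repr x) -(pres_repr y) -(pres_repr z).
by rewrite !pres_mulE catA.
Qed.

Lemma pres_mul1x : left_id pres_one pres_mul.
Proof. by move=> x; rewrite -(pres_repr x) pres_mulE. Qed.

Lemma pres_mulx1 : right_id pres_one pres_mul.
Proof. by move=> x; rewrite -(pres_repr x) pres_mulE cats0. Qed.

Lemma pres_mulVx : left_inverse pres_one pres_inv pres_mul.
Proof.
move=> x; rewrite -(pres_repr x) pres_invE pres_mulE.
exact/presP/word_eq_invl.
Qed.

Lemma pres_mulxV : right_inverse pres_one pres_inv pres_mul.
Proof.
move=> x; rewrite -(pres_repr x) pres_invE pres_mulE.
exact/presP/word_eq_invr.
Qed.

HB.instance Definition _ := isGroup.Build presented_group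
  pres_mulA pres_mul1x pres_mulx1 pres_mulVx pres_mulxV.

End Presentation.

Section TwoGenerators.

Let a := word_gen false.
Let x := word_gen true.

(* < a, x | x^p = a^(p^(n-1)) = 1, a^x = a^(1 + p^(n-2)) > *)
Definition G_group (p n : nat) : groupType :=
  presented_group [:: (word_exp x p, [::]);
                      (word_exp a (p ^ (n - 1))%N, [::]);
                      (word_conj a x, word_exp a (1 + p ^ (n - 2))%N)].

(* < a, x | x^2 = a^(2^(m-1)) = 1, a^x = a^(2^(m-2) - 1) > *)
Definition H_group (m : nat) : groupType :=
  presented_group [:: (word_exp x 2, [::]);
                      (word_exp a (2 ^ (m - 1))%N, [::]);
                      (word_conj a x, word_exp a (2 ^ (m - 2) - 1)%N)].

End TwoGenerators.

(* The direct sum of cyclic groups, 'Z_k being a group for addition; it has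
   order k only for k > 1, which holds here for p prime and n > 1. *)
Definition K_group (p n : nat) : groupType := ('Z_(p ^ (n - 1)) * 'Z_p)%type.

Definition D_group (n : nat) : groupType := ('D_(2 ^ n)%N)%type.

(* Main.v *)
Require Import Defs.
From HB Require Import structures.
From mathcomp Require Import all_boot all_fingroup.
From mathcomp Require Import all_algebra all_solvable zify.

(* For x in G let nb(x) be the set of y such that <x, y> is cyclic.  It is a
   union of cosets of Cyc(G), and outside Cyc(G) it is the closed
   non-neighbourhood of x in the non-cyclic graph.

   All four groups L are of the form <a><y> with |L| = p^n, a of order p^(n-1)
   and y, not in <a>, of order p; then Cyc(L) = 1, nb(a) = <a>, nb(y) = <y>.
   Suppose the graph of S is isomorphic to that of L.  As Cyc(S) embeds by
   translation into its finite complement, S is finite.  Put c = |Cyc(S)|.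
   Then c divides |nb(y)| - 1 = p - 1 in L.  The vertex of S corresponding to a
   has a pairwise, hence globally, cyclic nb, so S has a cyclic subgroup of
   order p^(n-1) - 1 + c, which must divide |S| = p^n - 1 + c; this forces
   c = 1.  So S is of the same form as L, and the classification of p-groups
   with a cyclic maximal subgroup leaves K, the modular group and, for p = 2,
   D and SD.  The last two are recognized by the number of x with |nb(x)| = 2,
   i.e., the number of involutions outside <a>.

   Finally (i, j) |-> y^j a^i maps cyclic subgroups of K onto cyclic subgroups
   of the modular group, because (y^j a^i)^k = y^(jk') a^(ik') with
   k' = k + p^(n-2) j C(k,2). *)

Set Implicit Arguments.
Unset Strict Implicit.
Unset Printing Implicit Defensive.

(** * Cyclicizers and the cyclic centre of a finite group *)

Section Cyclicizers.

Local Open Scope group_scope.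

Variable gT : finGroupType.
Implicit Types x y g : gT.

Definition cyc2 x y := cyclic <<[set x; y]>>.

(** This is the set nb(x). *)
Definition cyclicizer x := [set y | cyc2 x y].

Definition cyc_center : {set gT} := \bigcap_x cyclicizer x.

Lemma cyc2P x y : reflect (exists g, x \in <[g]> /\ y \in <[g]>) (cyc2 x y).
Proof.
apply: (iffP idP) => [/cyclicP[g defg]|[g [xg yg]]].
  by exists g; rewrite -defg !mem_gen // !inE eqxx ?orbT.
apply: cyclicS (cycle_cyclic g).
by rewrite gen_subG; apply/subsetP=> z; rewrite !inE => /orP[] /eqP->.
Qed.

Lemma cyc2C x y : cyc2 x y = cyc2 y x.
Proof. by rewrite /cyc2 setUC. Qed.

Lemma cyc2_refl x : cyc2 x x.
Proof. by apply/cyc2P; exists x; rewrite cycle_id. Qed.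

Lemma cycle_sub_cyclicizer x : <[x]> \subset cyclicizer x.
Proof.
by apply/subsetP=> y xy; rewrite inE; apply/cyc2P; exists x; rewrite cycle_id.
Qed.

(** The subgroups of a cyclic [p]-group form a chain, so inside a common [<[g]>] the element of
    smaller order is a power of the other. *)
Lemma pgroup_cyc2 (p : nat) x y : p.-group [set: gT] ->
  cyc2 x y = (x \in <[y]>) || (y \in <[x]>).
Proof.
move=> pG; apply/cyc2P/orP=> [[g [xg yg]]|[xy|yx]]; last 2 first.
- by exists y; rewrite cycle_id.
- by exists x; rewrite cycle_id.
have dvd_sub u v : u \in <[g]> -> v \in <[g]> ->
    #[u] %| #[v] -> u \in <[v]>.
  move=> ug vg; rewrite -!cycle_subG in ug vg *.
  by rewrite /order (cardSg_cyclic (cycle_cyclic g) ug vg).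
have [m1 o1] : {m | #[x] = (p ^ m)%N}.
  by apply: p_natP; apply: mem_p_elt pG _; rewrite inE.
have [m2 o2] : {m | #[y] = (p ^ m)%N}.
  by apply: p_natP; apply: mem_p_elt pG _; rewrite inE.
case: (leqP m1 m2) => [le|/ltnW le]; [left|right]; apply: dvd_sub => //;
  by rewrite o1 o2 dvdn_exp2l.
Qed.

Lemma cyc_centerP x : reflect (forall y, cyc2 x y) (x \in cyc_center).
Proof.
apply: (iffP bigcapP) => [xC y|xC y _]; last by rewrite inE cyc2C.
by rewrite cyc2C; have:= xC y isT; rewrite inE.
Qed.

(** Joining [c] to a common root [g] of [x] and [y] gives one [h] of which [c] and [g], hence [x]
    and [c * y], are powers. *)
Lemma cyc2_mul x y c : c \in cyc_center -> cyc2 x y -> cyc2 x (c * y).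
Proof.
move=> /cyc_centerP cC /cyc2P[g [xg yg]].
have /cyc2P[h [ch gh]] := cC g.
apply/cyc2P; exists h; split; first by move: xg; apply/subsetP; rewrite cycle_subG.
by rewrite groupM //; move: yg; apply/subsetP; rewrite cycle_subG.
Qed.

Lemma group_set_cyc_center : group_set cyc_center.
Proof.
apply/group_setP; split=> [|c d cC dC].
  by apply/cyc_centerP=> y; apply/cyc2P; exists y; rewrite group1 cycle_id.
apply/cyc_centerP=> y; rewrite cyc2C; apply: cyc2_mul => //.
by rewrite cyc2C; apply/cyc_centerP.
Qed.

Canonical cyc_center_group := Group group_set_cyc_center.

Lemma cyc_center_sub_cyclicizer x : cyc_center \subset cyclicizer x.
Proof. by apply/subsetP=> c /cyc_centerP cC; rewrite inE cyc2C. Qed.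

(** By [cyc2_mul], the cyclicizer is a disjoint union of right cosets of the cyclic centre. *)
Lemma dvdn_card_cyclicizer x : #|cyc_center| %| #|cyclicizer x|.
Proof.
have coverE : cover (rcosets cyc_center (cyclicizer x)) = cyclicizer x.
  symmetry.
  apply/setP=> y; apply/idP/bigcupP=> [xy|[A]].
    by exists (cyc_center :* y); [apply/rcosetsP; exists y|exact: rcoset_refl].
  case/rcosetsP=> z; rewrite inE => xz -> /rcosetP[c cC ->].
  by rewrite inE cyc2_mul.
suff part : partition (rcosets cyc_center (cyclicizer x)) (cyclicizer x).
  rewrite (card_uniform_partition (n := #|cyc_center|) _ part) ?dvdn_mull //.
  by move=> A /rcosetsP[y _ ->]; rewrite card_rcoset.
rewrite /partition coverE eqxx /=; apply/andP; split; last first.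
  apply/negP=> /rcosetsP[y _ /setP/(_ y)].
  by rewrite rcoset_refl inE.
apply/trivIsetP=> A B /rcosetsP[y _ ->] /rcosetsP[z _ ->] nyz.
rewrite -setI_eq0; apply/eqP/setP=> u; rewrite !inE.
apply/negP=> /andP[/rcoset_eqP uy /rcoset_eqP uz].
by rewrite -uy -uz eqxx in nyz.
Qed.

(** Pairwise cyclicity makes [<<A>>] abelian, so it is enough that its Sylow subgroups be cyclic.
    For a prime [q], the [q]-part of largest order among the elements of [A] has all the other
    [q]-parts as powers. *)
Lemma pairwise_cyclic_gen (A : {set gT}) :
  {in A &, forall x y, cyc2 x y} -> cyclic <<A>>.
Proof.
move=> cA.
have abA : abelian <<A>>.
  rewrite abelian_gen; apply/centsP=> x Ax y Ay.
  have /cyc2P[g [xg yg]] := cA x y Ax Ay.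
  by apply: (centsP (cycle_abelian g)).
apply: nil_Zgroup_cyclic (abelian_nil abA).
apply/forall_inP=> P /SylowP[q q_pr /and3P[sPA qP _]].
case: (set_0Vmem A) => [A0|[x0 Ax0]].
  by move: sPA; rewrite /= A0 gen0 => /trivgP->; apply: cyclic1.
case: (@arg_maxnP _ x0 (mem A) (fun x => #[x.`_q])) => // g Ag gmax.
apply: cyclicS (cycle_cyclic g.`_q); apply/subsetP=> z Pz.
have -> : z = z.`_q by rewrite constt_p_elt // (mem_p_elt qP).
(* The elements of [<<A>>] whose [q]-part is a power of that of [g] form a subgroup, because [<<A>>]
   is abelian; it contains [A], hence all of [<<A>>]. *)
have: <<A>> \subset <<A>> :&: [set u | u.`_q \in <[g.`_q]>].
  have gB : group_set (<<A>> :&: [set u | u.`_q \in <[g.`_q]>]).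
    apply/group_setP; split=> [|u v]; first by rewrite !inE group1 constt1 group1.
    rewrite !inE => /andP[Au gu] /andP[Av gv]; rewrite groupM // consttM ?groupM //.
    exact: (centsP abA).
  rewrite -[_ :&: _]/(gval (Group gB)) gen_subG; apply/subsetP=> u Au /=.
  rewrite !inE mem_gen //=.
  have /cyc2P[h [uh gh]] := cA u g Au Ag.
  have ch v : v \in <[h]> -> v.`_q \in <[h]>.
    by move=> vh; rewrite /constt groupX.
  have qo (v : gT) : exists k, #[v.`_q] = (q ^ k)%N.
    by have /p_natP[k] := p_elt_constt q v; exists k.
  have /= := gmax _ Au.
  have [k1 o1] := qo u; have [k2 o2] := qo g.
  rewrite -cycle_subG -(cardSg_cyclic (cycle_cyclic h)) ?cycle_subG ?ch //.
  rewrite -!orderE o1 o2 => le_ug.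
  by apply: dvdn_exp2l; rewrite -(leq_exp2l _ _ (prime_gt1 q_pr)).
by move/subsetP/(_ z (subsetP sPA z Pz)); rewrite !inE => /andP[].
Qed.

End Cyclicizers.

(** * Groups of order p^n with a cyclic subgroup of index p that has a complement *)

Section SplitExtremal.

Local Open Scope group_scope.

Variables (p n : nat) (gT : finGroupType) (x y : gT).
Hypotheses (p_pr : prime p) (n_gt2 : 2 < n).
Hypotheses (genG : extremal_generators [set: gT] p n (x, y)) (oy : #[y] = p).

(** As [<[x]>] has index [p], it contains [g ^+ p] for every [g]. A power [g ^+ k] equal to [z] lies
    outside [<[x]>], so [k] is prime to [p] and [z] generates [<[g]>]. *)
Lemma cyclicizer_notin z : z \notin <[x]> -> #[z] = p -> cyclicizer z = <[z]>.
Proof.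
move=> notXz oz; have [pG maxX nsXG _ _] := extremal_generators_facts p_pr genG.
apply/eqP; rewrite eqEsubset cycle_sub_cyclicizer andbT.
apply/subsetP=> u; rewrite inE => /cyc2P[g [/cycleP[k def_z] ug]].
have Xgp : g ^+ p \in <[x]>.
  apply: coset_idr; first by rewrite groupX // (subsetP (normal_norm nsXG)) ?inE.
  rewrite morphX ?(subsetP (normal_norm nsXG)) ?inE //.
  have <- : #|[set: gT] / <[x]>| = p.
    rewrite card_quotient ?normal_norm //.
    exact: p_maximal_index pG maxX.
  by rewrite expg_cardG // mem_quotient ?inE.
suff: generator <[g]> z by move/eqP<-.
rewrite def_z generator_coprime.
have [m ->] : {m | #[g] = (p ^ m)%N}.
  by apply: p_natP; apply: mem_p_elt pG _; rewrite inE.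
rewrite coprimeXl // prime_coprime //; apply: contra notXz => /dvdnP[j def_k].
by rewrite def_z def_k mulnC expgM groupX.
Qed.

(** Otherwise nb(y) would be the whole group, while it has only [p] elements. *)
Lemma split_extremal_not_cyclic : ~~ cyclic [set: gT].
Proof.
have [oG _ _ /setDP[_ notXy]] := genG.
apply/negP=> cG; have := cyclicizer_notin notXy oy.
have -> : cyclicizer y = setT.
  by apply/setP=> z; rewrite !inE; apply: cyclicS (subsetT _) cG.
move/(congr1 (fun A : {set gT} => #|A|)); rewrite oG -orderE oy -{2}(expn1 p).
by move/eqP; rewrite eqn_exp2l ?prime_gt1 // gtn_eqF // ltnW.
Qed.

(** By maximality of [<[x]>], a cyclic subgroup containing [x] is [<[x]>] or the whole group, and
    the latter is not cyclic. *)
Lemma cyclicizer_generator : cyclicizer x = <[x]>.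
Proof.
have [pG maxX nsXG _ _] := extremal_generators_facts p_pr genG.
apply/eqP; rewrite eqEsubset cycle_sub_cyclicizer andbT.
apply/subsetP=> u; rewrite inE => /cyc2P[g [xg ug]].
have /maxgroupP[_ maxXg] := maxX.
have [eqg|] := eqVneq <[g]> [set: gT].
  by have := split_extremal_not_cyclic; rewrite -eqg cycle_cyclic.
rewrite -properT => pr_g; rewrite -(maxXg <[g]>%G pr_g) //.
by rewrite cycle_subG.
Qed.

(** The cyclic centre lies in both nb(x) = [<[x]>] and nb(y) = [<[y]>], which meet trivially. *)
Lemma split_extremal_cyc_center : cyc_center gT = 1.
Proof.
have [oG _ ox /setDP[_ notXy]] := genG.
have cy := cyclicizer_notin notXy oy.
have cx := cyclicizer_generator.
apply/trivgP; apply: subset_trans (_ : <[x]> :&: <[y]> \subset _).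
  by rewrite subsetI -{1}cx -cy !cyc_center_sub_cyclicizer.
by rewrite setIC prime_TIg ?cycle_subG // -orderE oy.
Qed.

End SplitExtremal.

(** [extremal_generators] fixes the order p^n of the group and the order p^(n-1) of [x], and puts
    [y] outside [<[x]>]. The condition on the order of [y] makes [<[y]>] a complement; for n > 2
    this rules out cyclic and generalized quaternion groups. *)
Definition split_extremal p n (gT : finGroupType) :=
  exists x y : gT, extremal_generators [set: gT]%G p n (x, y) /\ #[y]%g = p.

(** * Graph isomorphisms between finite groups and the counts they preserve *)

Section CyclicityPreservingMaps.

Local Open Scope group_scope.

Variables (S L : finGroupType) (f : S -> L).

(** An isomorphism of non-cyclic graphs, written as a total map constrained only outside
    [cyc_center S]. Equality of [cyc2] replaces preservation of edges and also makes sense for equal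
    arguments. *)
Definition cyc_equiv := [/\ {in ~: cyc_center S &, injective f},
  f @: (~: cyc_center S) = ~: cyc_center L
  & {in ~: cyc_center S &, forall x y, cyc2 (f x) (f y) = cyc2 x y}].

Hypothesis equiv_f : cyc_equiv.

Lemma card_compl_cyc_center : #|~: cyc_center S| = #|~: cyc_center L|.
Proof. by have [injf <- _] := equiv_f; rewrite card_in_imset. Qed.

(** [f] carries the closed non-neighbourhood of [x] bijectively onto that of [f x]. *)
Lemma card_cyclicizerD x : x \notin cyc_center S ->
  #|cyclicizer (f x) :\: cyc_center L| = #|cyclicizer x :\: cyc_center S|.
Proof.
move=> Cx; have [injf imf cycf] := equiv_f.
rewrite -[RHS](card_in_imset (f := f)); last first.
  by move=> u v /setDP[_ Cu] /setDP[_ Cv]; apply: injf; rewrite inE.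
apply: eq_card => v; apply/setDP/imsetP=> [[]|[u /setDP[xu Cu] ->]].
  move=> xv Cv; have /imsetP[u] : v \in f @: (~: cyc_center S) by rewrite imf inE.
  rewrite inE => Cu def_v; exists u => //.
  by rewrite !inE Cu -cycf ?inE // -def_v; rewrite inE in xv.
have : f u \in ~: cyc_center L by rewrite -imf imset_f // inE.
by rewrite !inE cycf ?inE //; rewrite inE in xu.
Qed.

(** The same count with the subtractions moved across, so that no truncation occurs. *)
Lemma card_cyclicizer_subn x : x \notin cyc_center S ->
  (#|cyclicizer (f x)| + #|cyc_center S| =
   #|cyclicizer x| + #|cyc_center L|)%N.
Proof.
move=> Cx; have := card_cyclicizerD Cx.
rewrite !cardsD ![cyclicizer _ :&: _](setIidPr (cyc_center_sub_cyclicizer _)).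
have := subset_leq_card (cyc_center_sub_cyclicizer x).
have := subset_leq_card (cyc_center_sub_cyclicizer (f x)).
by move=> le1 le2 eq12; rewrite -(subnK le1) eq12 addnAC subnK.
Qed.

End CyclicityPreservingMaps.


(** Put d = c - 1. The divisor d + m also divides p(d + m) - (d + pm) = (p - 1)d. If d were
    positive, this would give d + m <= (p - 1)d <= p^2 <= m, which is absurd. *)
Lemma coprime_center_arith p c m : 1 < p -> 0 < c -> c %| p.-1 -> p ^ 2 <= m ->
  (c + m).-1 %| (c + p * m).-1 -> c = 1%N.
Proof.
case: p => // q; case: c => // d; rewrite /= => q_gt0 _ /(dvdn_leq q_gt0) le_dq.
move=> le_p2m dv.
have {}dv : d + m %| q * d.
  have -> : (q * d = q.+1 * (d + m) - (d + q.+1 * m))%N.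
    by rewrite mulnDr !mulSn; lia.
  by rewrite dvdn_sub // dvdn_mull.
case: d le_dq dv => // d le_dq dv.
have le1: d.+1 + m <= q * d.+1 by rewrite dvdn_leq // muln_gt0 andbT -ltnS.
have le2 : q * d.+1 <= q.+1 * q.+1 by rewrite leq_mul // ltnW // ltnW.
by move: le_p2m; rewrite -mulnn; lia.
Qed.

(** * Transfer of the split extremal structure along a graph isomorphism *)

Section Transfer.

Local Open Scope group_scope.

Variables (p n : nat) (S L : finGroupType) (f : S -> L).
Hypotheses (p_pr : prime p) (n_gt2 : 2 < n).
Hypotheses (sL : split_extremal p n L) (equiv_f : cyc_equiv f).

Let cL : cyc_center L = 1.
Proof. by have [x [y [gen oy]]] := sL; apply: split_extremal_cyc_center gen oy. Qed.

Let lift v : v != 1 -> exists2 u, u \notin cyc_center S & v = f u.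
Proof.
move=> v1; have [_ imf _] := equiv_f.
have: v \in f @: (~: cyc_center S) by rewrite imf cL !inE.
by case/imsetP=> u; rewrite inE => Cu ->; exists u.
Qed.

Let gt1_pn : 1 < p ^ n.-1.
Proof. by rewrite (ltn_exp2l 0) ?prime_gt1 // -(subnKC n_gt2). Qed.


(** Elements of nb(u) are pairwise cyclic: vertices by transport along [f], elements of the cyclic
    centre by definition. So nb(u) generates some [<[g]>], and [u] being a power of [g] gives the
    reverse inclusion. *)
Lemma cyclicizer_lift_cyclic u : u \notin cyc_center S ->
    {in cyclicizer (f u) &, forall v w, cyc2 v w} ->
  exists g, cyclicizer u = <[g]>.
Proof.
move=> Cu cfu; have [_ _ cycf] := equiv_f.
have /cyclicP[g defg] : cyclic <<cyclicizer u>>.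
  apply: pairwise_cyclic_gen => z w; rewrite !inE => uz uw.
  have [/cyc_centerP/(_ w)//|Cz] := boolP (z \in cyc_center S).
  have [/cyc_centerP/(_ z)|Cw] := boolP (w \in cyc_center S).
    by rewrite cyc2C.
  by rewrite -cycf ?inE // cfu // inE cycf ?inE.
exists g; apply/eqP; rewrite eqEsubset -{1}defg subset_gen.
have ug : u \in <[g]> by rewrite -defg mem_gen // inE cyc2_refl.
by apply/subsetP=> z zg; rewrite inE; apply/cyc2P; exists g.
Qed.

Lemma cyc_equiv_split_extremal :
  cyc_center S = 1 /\ split_extremal p n S.
Proof.
have [x [y [gen oy]]] := sL; have [oL _ ox /setDP[_ notXy]] := gen.
have p_gt1 := prime_gt1 p_pr.
have [x1 y1] : x != 1 /\ y != 1 by rewrite -!order_gt1 ox oy; split.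
have [[u Cu def_x] [v Cv def_y]] := (lift x1, lift y1).
have nbx := cyclicizer_generator p_pr n_gt2 gen oy.
have nby := cyclicizer_notin p_pr gen notXy oy.
have [g def_g] : exists g, cyclicizer u = <[g]>.
  apply: cyclicizer_lift_cyclic => // z w; rewrite -def_x nbx => xz xw.
  by apply/cyc2P; exists x.
have := card_cyclicizer_subn equiv_f Cu; rewrite -def_x nbx.
have := card_cyclicizer_subn equiv_f Cv; rewrite -def_y nby.
rewrite -!orderE oy ox cL cards1 def_g -orderE => cv og.
have oS : (#|[set: S]| + 1 = #|cyc_center S| + p ^ n)%N.
  have := card_compl_cyc_center equiv_f.
  have := cardsC (cyc_center S); have := cardsC (cyc_center L).
  by rewrite cL cards1 -[#|L|]cardsT oL cardsT => <- <- ->; lia.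
have c_gt0 : 0 < #|cyc_center S| by apply: cardG_gt0.
have cE : #|cyc_center S| = 1%N.
  (* With c the order of the cyclic centre, c divides |nb(v)| = p - 1 + c, and the order p^(n-1) - 1
     + c of [g] divides the order p^n - 1 + c of [S]. *)
  apply: (@coprime_center_arith p _ (p ^ n.-1)%N) => //.
  - have := dvdn_card_cyclicizer v.
    have -> : #|cyclicizer v| = (p.-1 + #|cyc_center S|)%N by lia.
    by rewrite dvdn_addl.
  - by rewrite leq_pexp2l ?prime_gt0 //; case: (n) n_gt2 => [|[|[|]]].
  have -> : (#|cyc_center S| + p ^ n.-1).-1 = #[g] by lia.
  have -> : (#|cyc_center S| + p * p ^ n.-1).-1 = #|[set: S]|.
    by rewrite -expnS prednK ?(ltnW (ltnW n_gt2)) //; lia.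
  by rewrite order_dvdG ?inE.
have C1 : cyc_center S = 1 by apply: card_le1_trivg; rewrite cE.
split=> //; move: cv og oS; rewrite cE => cv og oS.
have {}oS : #|[set: S]| = (p ^ n)%N by lia.
have pS : p.-group [set: S] by rewrite /pgroup oS pnatX pnat_id.
have {}og : #[g] = (p ^ n.-1)%N by lia.
have {}cv : #|cyclicizer v| = p by lia.
exists g, v; split.
  (* If [v] were a power of [g], then nb(v), with its [p] elements, would contain [<[g]>], of order
     p^(n-1) > p. *)
  split; rewrite ?inE // andbT; apply/negP=> gv.
  have : #|<[g]>| <= #|cyclicizer v|.
    apply/subset_leq_card/subsetP=> z gz; rewrite inE; apply/cyc2P.
    by exists g.
  rewrite -orderE og cv leqNgt -{1}(expn1 p) ltn_exp2l //.
  by case: (n) n_gt2 => [|[|[|]]].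
have v1 : v != 1 by move: Cv; rewrite C1 inE.
(* The order of [v] is a power of [p], greater than 1 and at most |nb(v)| = p. *)
have [m ov] : {m | #[v] = (p ^ m)%N}.
  by apply: p_natP; apply: mem_p_elt pS _; rewrite inE.
have := subset_leq_card (cycle_sub_cyclicizer v).
rewrite -orderE cv; move: v1; rewrite -order_gt1 ov => /[swap].
by rewrite -{2 3}(expn1 p) leq_exp2l //; case: (m) => [|[|]]; rewrite // expn1.
Qed.

(** Both cyclic centres are trivial, so [f] preserves |nb| at every non-identity element. The bound
    on [k] discards the identity, which is not a vertex and whose cyclicizer has p^n elements. *)
Lemma cyc_equiv_card_cyclicizer_eq k : k < p ^ n ->
  #|[set x : S | #|cyclicizer x| == k]| = #|[set x : L | #|cyclicizer x| == k]|.
Proof.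
have [C1 [_ [_ [[oS _ _ _] _]]]] := cyc_equiv_split_extremal.
have [_ [_ [[oL _ _ _] _]]] := sL.
have [injf imf _] := equiv_f.
have cyc1 (gT : finGroupType) : cyclicizer (1 : gT) = setT.
  by apply/setP=> z; rewrite !inE; apply/cyc2P; exists z; rewrite group1 cycle_id.
move=> ltk.
have nz (gT : finGroupType) (x : gT) : #|[set: gT]| = (p ^ n)%N ->
    #|cyclicizer x| == k -> x != 1.
  by move=> o xk; apply: contraTneq xk => ->; rewrite cyc1 o gtn_eqF.
rewrite -(card_in_imset (f := f)) => [|u v]; last first.
  by rewrite !inE => /(nz _ _ oS) u1 /(nz _ _ oS) v1; apply: injf; rewrite !inE C1 inE.
have cyceq u : u != 1 -> #|cyclicizer (f u)| = #|cyclicizer u|.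
  move=> u1; have := @card_cyclicizer_subn _ _ _ equiv_f u.
  by rewrite C1 cL !cards1 inE => /(_ u1)/eqP; rewrite eqn_add2r => /eqP.
apply: eq_card => v; apply/imsetP/idP=> [[u]|].
  by rewrite !inE => uk ->; rewrite cyceq // (nz _ _ oS uk).
rewrite !inE => vk; have [u Cu def_v] := lift (nz _ _ oL vk).
by exists u => //; rewrite inE -cyceq -?def_v //; rewrite C1 inE in Cu.
Qed.

End Transfer.

(** The group [K_group p n] again, now with its finite structure, so that finite group theory
    applies to it. *)
Definition K_finGroup (p n : nat) : finGroupType :=
  ('Z_(p ^ (n - 1)) * 'Z_p)%type.

(** * Classification of split extremal groups *)

Section Classification.

Local Open Scope group_scope.

Variables (p n : nat).
Hypotheses (p_pr : prime p) (n_gt2 : 2 < n).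

Lemma split_extremal_abelian_dprod (gT : finGroupType) (x y : gT) :
  extremal_generators [set: gT] p n (x, y) -> #[y] = p -> abelian [set: gT] ->
  <[x]> \x <[y]> = [set: gT].
Proof.
move=> gen oy abG; have [_ _ _ /setDP[_ notXy]] := gen.
have [_ _ _ defG _] := extremal_generators_facts p_pr gen.
rewrite dprodE //; first by apply: centSS abG; apply: subsetT.
by rewrite setIC prime_TIg ?cycle_subG // -orderE oy.
Qed.

Lemma split_extremal_abelian_isog (S L : finGroupType) :
  split_extremal p n S -> abelian [set: S] ->
  split_extremal p n L -> abelian [set: L] -> [set: S] \isog [set: L].
Proof.
move=> [x [y [gS oy]]] abS [u [v [gL ov]]] abL.
apply: isog_dprod (split_extremal_abelian_dprod gS oy abS)
  (split_extremal_abelian_dprod gL ov abL) _ _.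
  have [_ _ ox _] := gS; have [_ _ ou _] := gL.
  by rewrite isog_cyclic_card ?cycle_cyclic // -!orderE ox ou eqxx.
by rewrite isog_cyclic_card ?cycle_cyclic // -!orderE oy ov eqxx.
Qed.

Lemma K_finGroup_abelian : abelian [set: K_finGroup p n].
Proof.
by apply/centsP=> -[a b] _ [c d] _; congr (_, _); rewrite /= /mulg /= GRing.addrC.
Qed.

Lemma K_finGroup_split_extremal : split_extremal p n (K_finGroup p n).
Proof.
have p_gt1 := prime_gt1 p_pr.
have q_gt1 : 1 < p ^ (n - 1).
  by rewrite (ltn_exp2l 0) //; case: (n) n_gt2 => [|[|[|]]].
(* In multiplicative notation [1] is the zero of a factor, and [Zp1] is its standard generator. *)
pose x : K_finGroup p n := (Zp1, 1); pose y : K_finGroup p n := (1, Zp1).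
exists x, y; have ox : #[x] = (p ^ n.-1)%N.
  rewrite -[x]/(pairg1 _ Zp1) (order_injm (injm_pairg1 _ _)) ?inE //.
  by rewrite order_Zp1 Zp_cast // subn1.
have oy : #[y] = p.
  rewrite -[y]/(pair1g _ Zp1) (order_injm (injm_pair1g _ _)) ?inE //.
  by rewrite order_Zp1 Zp_cast.
split=> //; split; rewrite ?inE //.
  rewrite cardsT card_prod !card_ord !Zp_cast // -expnSr.
  by rewrite subn1 prednK // ltnW // ltnW.
rewrite andbT; apply/cycleP=> -[k]; rewrite /x.
have -> : ((Zp1, 1) : K_finGroup p n) ^+ k = (Zp1 ^+ k, 1 ^+ k).
  by elim: k => // k IHk; rewrite !expgS IHk.
rewrite expg1n => -[_]; apply/eqP.
by rewrite -(order_gt1 (Zp1 : 'Z_p)) order_Zp1 Zp_cast.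
Qed.

Lemma K_finGroup_pgroup : p.-group [set: K_finGroup p n].
Proof.
have [x [y [gen _]]] := K_finGroup_split_extremal.
by have [] := extremal_generators_facts p_pr gen.
Qed.

(** An abelian group of this form is [<[x]> \x <[y]>], hence K. A nonabelian [p]-group with a cyclic
    maximal subgroup is modular or, for p = 2, dihedral, semidihedral or quaternion. The bound
    [(p == 2) + 3 <= n] keeps the modular case apart from the dihedral group of order 8. *)
Lemma split_extremal_class (S : finGroupType) : split_extremal p n S ->
  [\/ [set: S] \isog [set: K_finGroup p n],
      (p == 2) + 3 <= n /\ [set: S] \isog 'Mod_(p ^ n),
      p = 2 /\ [set: S] \isog 'D_(2 ^ n)
    | [/\ p = 2, 3 < n & [set: S] \isog 'SD_(2 ^ n)]].
Proof.
move=> sS; have [x [y [gen oy]]] := sS; have [oS _ ox /setDP[_ notXy]] := gen.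
have [pG maxX _ _ _] := extremal_generators_facts p_pr gen.
have [abS|nabS] := boolP (abelian [set: S]).
  apply: Or41; apply: split_extremal_abelian_isog => //.
    exact: K_finGroup_split_extremal.
  exact: K_finGroup_abelian.
have n_gt0 : 0 < n by case: (n) n_gt2.
(* The class theorems yield a group of some order q^m; comparing orders gives q = p and m = n. *)
have same_exp q m (gT : finGroupType) (G : {group gT}) : prime q -> #|G| = (q ^ m)%N ->
    [set: S] \isog G -> q = p /\ m = n.
  move=> q_pr oG /card_isog; rewrite oS oG => e.
  have qp : q = p.
    have: p %| q ^ m by rewrite -e dvdn_exp.
    rewrite Euclid_dvdX // => /andP[pq _]; symmetry; apply/eqP.
    by rewrite -dvdn_prime2.
  split=> //; apply/eqP; rewrite -(eqn_exp2l _ _ (prime_gt1 p_pr)) e qp eqxx //.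
have := maximal_cycle_extremal pG nabS (cycle_cyclic x) (subsetT _)
  (p_maximal_index pG maxX).
case/orP=> [/eqP/modular_group_classP[q q_pr [m m_ge isoS]]|].
  have m_gt2 : 2 < m by apply: leq_trans m_ge; rewrite leq_addl.
  have [eq em] := same_exp _ _ _ _ q_pr (card_modular_group q_pr m_gt2) isoS.
  by apply: Or42; rewrite -eq -em.
case/andP=> /eqP p2; rewrite /extremal2 !inE => /or3P[] /eqP.
- case/dihedral_classP=> m m_gt1 isoS; apply: Or43.
  have [_ em] := same_exp 2 m _ _ isT (card_2dihedral m_gt1) isoS.
  by rewrite -em.
- case/semidihedral_classP=> m m_gt1 isoS; apply: Or44.
  have [_ em] := same_exp 2 m _ _ isT (card_semidihedral m_gt1) isoS.
  by rewrite -em.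
case/quaternion_classP=> m m_gt1 isoS.
have [_ em] := same_exp 2 m _ _ isT (card_quaternion m_gt1) isoS.
rewrite {}em in isoS m_gt1; move: gen; rewrite p2 => gen.
(* In a quaternion group every element outside [<[x]>] has order 4, whereas [y] has order 2. *)
have [[_ ord4 _] _ _ _ _] := quaternion_structure m_gt1 gen isoS.
have := ord4 y; rewrite !inE notXy oy p2; by move/(_ isT).
Qed.

End Classification.

(** * Counting involutions outside the cyclic maximal subgroup of a 2-group *)

Section Involutions.

Local Open Scope group_scope.

Definition num_cyclicizer2 (gT : finGroupType) :=
  #|[set u : gT | #|cyclicizer u| == 2]|.

Section InvolutionsOf.

Variable gT : finGroupType.

Lemma card_Ldiv2_isog (rT : finGroupType) (G : {group gT}) (H : {group rT}) :
  G \isog H -> #|'Ldiv_2(G)| = #|'Ldiv_2(H)|.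
Proof.
case/isogP=> f injf <-; rewrite -(card_in_imset (f := f)); last first.
  by move=> u v /setIP[Gu _] /setIP[Gv _]; apply: (injmP injf).
apply: eq_card => w; apply/imsetP/setIP => [[u /setIP[Gu]]|].
  rewrite inE => /eqP u2 ->; split; first exact: mem_morphim.
  by rewrite !inE -morphX ?u2 ?morph1.
case=> /morphimP[u _ Gu ->]; rewrite inE -morphX // => /eqP fu2.
exists u => //; rewrite !inE Gu; apply/eqP/(injmP injf); rewrite ?groupX //.
by rewrite fu2 morph1.
Qed.

Lemma card_Ldiv2_cycle k (x : gT) : #[x] = (2 ^ k.+1)%N -> #|'Ldiv_2(<[x]>)| = 2.
Proof.
move=> ox; have pX : 2.-group <[x]> by rewrite /pgroup -orderE ox pnatX.
rewrite -[X in 'Ldiv_X(_)](expn1 2) -(OhmEabelian (n := 1) pX).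
  apply: (Ohm1_cyclic_pgroup_prime (cycle_cyclic x) pX).
  by rewrite -cardG_gt1 -orderE ox (ltn_exp2l 0).
exact: abelianS (Ohm_sub _ _) (cycle_abelian x).
Qed.

Section SplitExtremal2Group.

Variables (n : nat) (x y : gT).
Hypotheses (n_gt2 : 2 < n) (gen : extremal_generators [set: gT] 2 n (x, y)).

(** For [u] in [<[x]>], nb(u) contains [<[x]>] and so has more than two elements. For an involution
    [u] outside [<[x]>], nb(u) is [<[u]>]. Conversely |nb(u)| = 2 bounds the order of [u] by 2. *)
Lemma num_cyclicizer2E : num_cyclicizer2 gT = #|'Ldiv_2() :\: <[x]>|.
Proof.
apply: eq_card => u; have [oG _ ox _] := gen.
apply/idP/setDP => [|[]].
  rewrite inE => /eqP nb2; have ux : u \notin <[x]>.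
    apply/negP=> Xu; have : #|<[x]>| <= #|cyclicizer u|.
      apply/subset_leq_card/subsetP=> z zx; rewrite inE.
      by apply/cyc2P; exists x.
    by rewrite nb2 -orderE ox -{2}(expn1 2) leq_exp2l //; case: (n) n_gt2 => [|[|[|]]].
  split=> //; have := subset_leq_card (cycle_sub_cyclicizer u).
  rewrite nb2 -orderE inE; have := order_gt0 u; have := expg_order u.
  by case: #[u] => [|[|[|]]] //; rewrite ?expg1 => ->; rewrite ?expg1n.
rewrite !inE => /eqP u2 notXu; rewrite (cyclicizer_notin _ gen) //; last first.
  by apply: nt_prime_order u2 _ => //; apply: contraNneq notXu => ->.
by rewrite -orderE (nt_prime_order _ u2) //; apply: contraNneq notXu => ->.
Qed.

(** The two additional solutions of [u ^+ 2 = 1] are those in [<[x]>]. The left side does not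
    mention the generators, so it can be computed in an isomorphic group. *)
Lemma card_Ldiv2_num_cyclicizer2 :
  #|'Ldiv_2([set: gT])| = num_cyclicizer2 gT + 2.
Proof.
rewrite num_cyclicizer2E addnC -(cardsID <[x]> 'Ldiv_2(_)) setTI; congr (_ + _).
rewrite setIC (@card_Ldiv2_cycle n.-2) //; have [_ _ -> _] := gen.
by case: (n) n_gt2 => [|[|]].
Qed.

(** Left translation by [y^-1] maps the involutions outside [<[x]>] into the two solutions of
    [u ^+ 2 = 1] inside [<[x]>]. *)
Lemma num_cyclicizer2_abelian : #[y] = 2 -> abelian [set: gT] ->
  num_cyclicizer2 gT <= 2.
Proof.
move=> oy abG; rewrite num_cyclicizer2E.
have [_ _ ox /setDP[_ notXy]] := gen.
have y2 : y ^+ 2 = 1 by rewrite -oy expg_order.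
rewrite -[leqRHS](@card_Ldiv2_cycle n.-2 x); last first.
  by rewrite ox; case: (n) n_gt2 => [|[|]].
rewrite -[leqRHS](card_lcoset _ y); apply/subset_leq_card/subsetP=> u.
case/setDP; rewrite inE => /eqP u2 notXu; rewrite mem_lcoset !inE.
apply/andP; split; last first.
  rewrite expgMn; last by apply: (centsP abG); rewrite inE.
  by rewrite u2 expgVn y2 invg1 mulg1.
have [pG maxX nsXG defG _] := extremal_generators_facts (isT : prime 2) gen.
have: u \in <[x]> * <[y]> by rewrite defG inE.
case/mulsgP=> a b Xa /cycleP[k ->] def_u.
have [odk|evk] := boolP (odd k); last first.
  case/negP: notXu; rewrite def_u -(odd_double_half k) (negbTE evk) add0n.
  by rewrite -mul2n expgM y2 expg1n mulg1.
rewrite def_u -(odd_double_half k) odk expgD expg1 -mul2n expgM y2 expg1n mulg1.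
by rewrite (centsP abG y^-1 _ (a * y)) ?inE // mulgK.
Qed.

(** All elements outside [<[x]>] are involutions, and they make up half of the group. *)
Lemma num_cyclicizer2_dihedral : [set: gT] \isog 'D_(2 ^ n) ->
  num_cyclicizer2 gT = (2 ^ n.-1)%N.
Proof.
move=> isoG; rewrite num_cyclicizer2E.
have [[_ out2 _] _ _ _ _] := dihedral2_structure (ltnW n_gt2) gen isoG.
have -> : 'Ldiv_2() :\: <[x]> = ~: <[x]>.
  apply/setP=> u; rewrite !inE; case Xu: (u \in <[x]>) => //=.
  by rewrite -(out2 u) ?expg_order ?eqxx // !inE Xu.
have [oG _ ox _] := gen; apply: (@addnI #|<[x]>|); rewrite cardsC -cardsT oG.
by rewrite -orderE ox addnn -mul2n -expnS; case: (n) n_gt2.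
Qed.

End SplitExtremal2Group.

End InvolutionsOf.

Lemma card_Ldiv2_dihedral n : 2 < n -> #|'Ldiv_2('D_(2 ^ n))| = (2 ^ n.-1 + 2)%N.
Proof.
move=> n_gt2; have [[x y] gen _] := generators_2dihedral (ltnW n_gt2) (isog_refl _).
rewrite (card_Ldiv2_num_cyclicizer2 n_gt2 gen) (num_cyclicizer2_dihedral n_gt2 gen) //.
exact: isog_refl.
Qed.

(** All solutions of [u ^+ 2 = 1] lie in the first Ohm subgroup, which is generated by the
    conjugates of [y] and is dihedral of order 2^(n-1). *)
Lemma num_cyclicizer2_semidihedral n (gT : finGroupType) : 3 < n ->
  [set: gT] \isog 'SD_(2 ^ n) -> num_cyclicizer2 gT = (2 ^ n.-2)%N.
Proof.
move=> n_gt3 isoG; have [[x y] gen [oy _]] := generators_semidihedral n_gt3 isoG.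
have [_ _ [_ _ [ohm _] _] _ [isoM _ _]] := semidihedral_structure n_gt3 gen isoG oy.
have [p2G _ _ _ _] := extremal_generators_facts (isT : prime 2) gen.
apply: (@addIn 2); rewrite -(card_Ldiv2_num_cyclicizer2 (ltnW n_gt3) gen).
have -> : 'Ldiv_2([set: gT]) = 'Ldiv_2(<<y ^: [set: gT]>>).
  apply/setP=> u; rewrite !inE /=; case u2: (u ^+ 2 == 1); rewrite ?andbF //=.
  rewrite andbT; symmetry; rewrite -ohm (OhmE 1 p2G) mem_gen //.
  by rewrite !inE expn1.
rewrite (card_Ldiv2_isog isoM) card_Ldiv2_dihedral //.
by case: (n) n_gt3 => [|[|[|]]].
Qed.

End Involutions.

(* The sum is k times 1 + p^(n-2) j (k-1)/2, which is a p-adic unit except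
   possibly when p = 2 and n = 3. *)
Lemma binomial2_twist_dvdn p n j k s : prime p -> 2 < n -> 3 < n \/ 2 < p ->
  p ^ s %| k + p ^ n.-2 * j * 'C(k, 2) -> p ^ s %| k.
Proof.
move=> p_pr n_gt2 n_p; have binE : 'C(k, 2) * 2 = k * k.-1.
  by rewrite bin2 muln2 halfK; case: k => // k; rewrite oddM /= andNb subn0.
have [p_gt2 | p_le2] := ltnP 2 p.
  (* For odd [p], doubling clears the denominator of the binomial coefficient and leaves the
     cofactor of [k] congruent to 2 modulo [p]. *)
  move/(dvdn_mulr 2); have -> : (k + p ^ n.-2 * j * 'C(k, 2)) * 2 =
      k * (2 + p * (p ^ (n - 3) * j * k.-1)).
    rewrite mulnDl -!mulnA binE mulnDr; congr (_ + _).
    rewrite [p * _]mulnA -expnS; have -> : (n - 3).+1 = n.-2 by lia.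
    by rewrite [RHS]mulnCA; congr (_ * _); rewrite mulnCA.
  rewrite Gauss_dvdl // coprimeXl // prime_coprime //.
  by rewrite dvdn_addl ?dvdn_mulr // gtnNdvd.
have p2 : p = 2 by apply/eqP; rewrite eqn_leq p_le2 prime_gt1.
have n_gt3 : 3 < n by case: n_p => //; rewrite p2.
(* For p = 2 the halved coefficient 2^(n-3) is still even because n > 3. *)
have -> : k + p ^ n.-2 * j * 'C(k, 2) = k * (1 + p * (p ^ (n - 4) * j * k.-1)).
  apply/eqP; rewrite -(eqn_pmul2r (isT : 0 < 2)) mulnDl -!mulnA binE.
  rewrite mulnDl mul1n mulnDr; apply/eqP; congr (_ + _).
  have -> : n.-2 = ((n - 4)).+2 by lia.
  rewrite p2 !expnS; nia.
rewrite Gauss_dvdl // coprimeXl // prime_coprime //.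
by rewrite dvdn_addl ?dvdn_mulr // p2.
Qed.

(** * A cyclicity-preserving bijection from K to the modular group *)

Section ModularGraph.

Local Open Scope group_scope.

Variables (p n : nat) (gT : finGroupType) (x y : gT).
Hypotheses (p_pr : prime p) (n_gt2 : 2 < n) (n_p : 3 < n \/ 2 < p).
Hypotheses (gen : extremal_generators [set: gT] p n (x, y)).
Hypotheses (oy : #[y] = p) (xy : x ^ y = x ^+ (p ^ n.-2).+1).

Let r := (p ^ n.-2)%N.
Let q := (p ^ n.-1)%N.

Let ox : #[x] = q. Proof. by have [_ _ ->] := gen. Qed.

Let commE : [~ x, y] = x ^+ r.
Proof. by rewrite commgEl xy expgS mulKg. Qed.

Let r_square : q %| r * r.
Proof.
rewrite -expnD dvdn_exp2l //; case: (n) n_gt2 => [|[|[|m]]] //= _.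
by rewrite addnS ltnS leq_addr.
Qed.

Let p_dvd_r : p %| r.
Proof. by apply: dvdn_exp; case: (n) n_gt2 => [|[|[|m]]]. Qed.

Let cx : commute x [~ x, y].
Proof. by rewrite commE; apply: commuteX. Qed.

(** Conjugation by [y] turns [x ^+ r] into [x ^+ (r + r * r)], and [q] divides [r * r]. *)
Let cy : commute y [~ x, y].
Proof.
apply/esym/commgP/conjg_fixP; rewrite commE conjXg xy -expgM mulSn expgD.
by rewrite [x ^+ (r * r)](_ : _ = 1) ?mulg1 //; apply/eqP; rewrite -order_dvdn ox.
Qed.

(** The components of [u] are read as natural exponents. The map is not a homomorphism; it is meant
    to carry cyclic subgroups to cyclic subgroups. *)
Definition modular_map (u : K_finGroup p n) : gT := y ^+ u.2 * x ^+ u.1.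

Lemma K_expgE (u : K_finGroup p n) k : u ^+ k = (u.1 ^+ k, u.2 ^+ k).
Proof. by case: u => i j; elim: k => // k IHk; rewrite !expgS IHk. Qed.

Lemma modular_map_exp (u : K_finGroup p n) k :
  modular_map (u ^+ k) = y ^+ (u.2 * k) * x ^+ (u.1 * k).
Proof.
have p_gt1 := prime_gt1 p_pr.
have q_gt1 : 1 < p ^ (n - 1).
  by rewrite (ltn_exp2l 0) //; case: (n) n_gt2 => [|[|[|]]].
have expZ m (i : 'Z_m) (z : gT) : 1 < m -> #[z] = m -> z ^+ (i ^+ k) = z ^+ (i * k).
  move=> m_gt1 oz; rewrite Zp_expg /=; move: (i * k)%N => a; rewrite Zp_cast //.
  by rewrite -oz expg_mod_order.
by rewrite /modular_map K_expgE /= !expZ // ox /q subn1.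
Qed.

(** The commutator is central in [<[x]> <[y]>], so collection produces the factor
    [x ^+ (r * u.1 * u.2 * 'C(k, 2))]. It is absorbed into the exponent of [x]; the same change in
    the exponent of [y] is invisible because [p] divides [r]. *)
Lemma exp_modular_map (u : K_finGroup p n) k :
  modular_map u ^+ k = modular_map (u ^+ (k + r * u.2 * 'C(k, 2))).
Proof.
rewrite modular_map_exp /modular_map.
have xyE : [~ x ^+ u.1, y ^+ u.2] = [~ x, y] ^+ (u.1 * u.2) by apply: commXXg.
rewrite expMg_Rmul ?xyE; try by apply: commuteX; apply/commute_sym/commuteX/commute_sym.
rewrite commE -!expgM -mulgA -expgD; congr (_ * x ^+ _); last first.
  by rewrite mulnDr; congr (_ + _); rewrite -!mulnA [RHS]mulnCA.
rewrite mulnDr expgD [X in _ = _ * X](_ : _ = 1) ?mulg1 //.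
by apply/eqP; rewrite -order_dvdn oy dvdn_mull // -mulnA dvdn_mulr.
Qed.

Lemma modular_map_inj : injective modular_map.
Proof.
have [oG _ _ _] := gen; have [_ _ _ defG nXY] := extremal_generators_facts p_pr gen.
have [_ [_ [[oK _ _ _] _]]] := K_finGroup_split_extremal p_pr n_gt2.
suff: modular_map @: setT = setT.
  move/(congr1 (fun A : {set gT} => #|A|)); rewrite oG -oK => /eqP/imset_injP injf.
  by move=> u v; apply: injf; rewrite inE.
apply/setP=> g; rewrite inE; apply/imsetP.
have: g \in <[y]> * <[x]> by rewrite (normC nXY) defG inE.
case/mulsgP=> _ _ /cycleP[j ->] /cycleP[i ->] ->.
pose a : K_finGroup p n := (inZp i, inZp j).
exists a; rewrite ?inE // /modular_map /=.
have p_gt1 := prime_gt1 p_pr.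
have q_gt1 : 1 < p ^ (n - 1).
  by rewrite (ltn_exp2l 0) //; case: (n) n_gt2 => [|[|[|]]].
rewrite [X in _ ^+ (j %% X)](_ : _ = p); last exact: Zp_cast.
rewrite [X in _ ^+ (i %% X)](_ : _ = q); last by rewrite /q -subn1; apply: Zp_cast.
by rewrite -{1}oy -ox !expg_mod_order.
Qed.

(** [exp_modular_map] puts the right side inside the left. For equal size, take [k] to be the order
    of the image: the twisted exponent of [k] kills [u], so the order of [u] divides it, and by
    [binomial2_twist_dvdn] divides [k]. *)
Lemma modular_map_cycle u : modular_map @: <[u]> = <[modular_map u]>.
Proof.
have pK := K_finGroup_pgroup p_pr n_gt2.
apply/eqP; rewrite eq_sym eqEcard card_imset; last exact: modular_map_inj.
apply/andP; split.
  by apply/subsetP=> _ /cycleP[k ->]; rewrite exp_modular_map imset_f ?mem_cycle.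
rewrite -!orderE; apply: dvdn_leq => //.
have [s ou] : {s | #[u] = (p ^ s)%N}.
  by apply: p_natP; apply: mem_p_elt pK _; rewrite inE.
rewrite ou; apply: (@binomial2_twist_dvdn p n u.2) => //.
rewrite -ou order_dvdn; apply/eqP/modular_map_inj.
by rewrite -exp_modular_map expg_order /modular_map mulg1.
Qed.

(** In a [p]-group, [cyc2] only asks whether one element lies in the cycle of the other. *)
Lemma modular_map_cyc2 u v : cyc2 (modular_map u) (modular_map v) = cyc2 u v.
Proof.
have pK := K_finGroup_pgroup p_pr n_gt2.
have [pG _ _ _ _] := extremal_generators_facts p_pr gen.
rewrite (pgroup_cyc2 _ _ pK) (pgroup_cyc2 _ _ pG) -!modular_map_cycle.
by rewrite !mem_imset //; apply: modular_map_inj.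
Qed.

End ModularGraph.

From mathcomp Require Import boolp classical_sets cardinality.

(** * Generated subgroups and Cyc in arbitrary, possibly infinite, groups *)

Section GeneratedSubgroups.

Local Open Scope group_scope.
Local Open Scope classical_set_scope.

Variable G : groupType.
Implicit Types (x y z g v : G) (H A : set G).

Lemma generated_subgroupP A : is_subgroup (generated_subgroup A).
Proof.
split=> [H [[H1 _] _] //|x y Ax Ay H HH].
by have [[_ HD] _] := HH; apply: HD; [apply: Ax|apply: Ay].
Qed.

Lemma sub_generated_subgroup A : A `<=` generated_subgroup A.
Proof. exact: sub_smallest. Qed.

Lemma generated_subgroup_sub A H :
  is_subgroup H -> A `<=` H -> generated_subgroup A `<=` H.
Proof. exact: smallest_sub. Qed.

Lemma subgroupV H x : is_subgroup H -> H x -> H x^-1.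
Proof. by case=> H1 HD Hx; rewrite -[x^-1]mul1g; apply: HD. Qed.

Lemma subgroupM H x y : is_subgroup H -> H x -> H y -> H (x * y).
Proof. by move=> HH Hx Hy; rewrite -[y]invgK; apply: HH.2 (subgroupV HH Hy). Qed.

Lemma subgroupX H x k : is_subgroup H -> H x -> H (x ^+ k).
Proof.
by move=> HH Hx; elim: k => [|k IHk]; [apply: HH.1 | rewrite expgS; apply: subgroupM].
Qed.

Lemma generated_subgroup1P g z :
  generated_subgroup [set g] z <-> exists k, z = g ^+ k \/ z = g ^- k.
Proof.
split=> [|[k]]; last first.
  have gg : generated_subgroup [set g] (g ^+ k).
    apply: (subgroupX _ (generated_subgroupP _)).
    exact: sub_generated_subgroup.
  by case=> -> //; apply: subgroupV gg; apply: generated_subgroupP.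
move: z; apply: generated_subgroup_sub => [|_ ->]; last by exists 1%N; left; rewrite expg1.
have subE (i j : nat) : exists k, g ^+ i * g ^- j = g ^+ k \/ g ^+ i * g ^- j = g ^- k.
  case: (leqP j i) => [le|/ltnW le].
    by exists (i - j)%N; left; rewrite -{1}(subnK le) expgD mulgK.
  by exists (j - i)%N; right; rewrite -{1}(subnK le) expgD invgM mulVKg.
have subE' (i j : nat) : exists k, g ^- i * g ^+ j = g ^+ k \/ g ^- i * g ^+ j = g ^- k.
  case: (leqP i j) => [le|/ltnW le].
    by exists (j - i)%N; left; rewrite -{1}(subnKC le) expgD mulKg.
  by exists (i - j)%N; right; rewrite -{1}(subnKC le) expgD invgM mulgVK.
split=> [|_ _ [i [->|->]] [j [->|->]]]; first by exists 0%N; left.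
- exact: subE.
- by exists (i + j)%N; left; rewrite invgK expgD.
- by exists (j + i)%N; right; rewrite expgD invgM.
- by rewrite invgK; apply: subE'.
Qed.

(** The least positive [k] with [v ^+ k] in [H] yields a generator, by division with remainder; if
    there is none, [H] is trivial. *)
Lemma subgroup_of_cyclic H v :
  is_subgroup H -> H `<=` generated_subgroup [set v] -> is_cyclic H.
Proof.
move=> HH Hv; have HVE z : H z^-1 -> H z by move/(subgroupV HH); rewrite invgK.
have [[k k_gt0 Hk]|nk] := pselect (exists2 k, 0 < k & H (v ^+ k)).
  have exk : exists k, `[< 0 < k /\ H (v ^+ k) >] by exists k; apply/asboolP.
  case: (ex_minnP exk) => {Hk k_gt0}k /asboolP[k_gt0 Hk] mink.
  have Hdvd m : H (v ^+ m) -> k %| m.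
    move=> Hm; apply: contraT; rewrite /dvdn -lt0n => r_gt0.
    have: k <= m %% k.
      apply/mink/asboolP; split=> //.
      rewrite -(mulKg (v ^+ (m %/ k * k)) (v ^+ (m %% k))) -expgD -divn_eq.
      apply: subgroupM => //; apply: subgroupV => //.
      by rewrite mulnC expgM; apply: subgroupX.
    by rewrite leqNgt ltn_pmod.
  exists (v ^+ k); rewrite eqEsubset; split; last first.
    by apply: generated_subgroup_sub => // _ ->.
  move=> z Hz; have [m [def_z|def_z]] := (generated_subgroup1P v z).1 (Hv z Hz);
    apply/generated_subgroup1P; rewrite def_z in Hz *.
    by have /dvdnP[j ->] := Hdvd m Hz; exists j; left; rewrite mulnC expgM.
  by have /dvdnP[j ->] := Hdvd m (HVE _ Hz); exists j; right; rewrite mulnC expgM.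
exists 1; rewrite eqEsubset; split; last first.
  by apply: generated_subgroup_sub => // _ ->; apply: HH.1.
move=> z Hz; suff -> : z = 1 by apply: sub_generated_subgroup.
have [[|m] [def_z|def_z]] := (generated_subgroup1P v z).1 (Hv z Hz).
- by rewrite def_z.
- by rewrite def_z invg1.
- by case: nk; exists m.+1; rewrite // -def_z.
- by case: nk; exists m.+1; rewrite //; apply: HVE; rewrite -def_z.
Qed.

Lemma cyclic2P x y : is_cyclic (generated_subgroup [set x; y]) <->
  exists g, generated_subgroup [set g] x /\ generated_subgroup [set g] y.
Proof.
split=> [[g defg]|[g [gx gy]]].
  by exists g; rewrite -defg; split; apply: sub_generated_subgroup; [left|right].
apply: (subgroup_of_cyclic (generated_subgroupP _)) (_ : _ `<=` generated_subgroup [set g]).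
apply: generated_subgroup_sub => [|z [] ->] //; exact: generated_subgroupP.
Qed.

Lemma Cyc_mul c d : Cyc G c -> Cyc G d -> Cyc G (c * d).
Proof.
move=> Cc Cd y; have /cyclic2P[g [dg yg]] := Cd y.
have /cyclic2P[h [ch gh]] := Cc g.
have sub_gh : generated_subgroup [set g] `<=` generated_subgroup [set h].
  by apply: generated_subgroup_sub => [|_ ->] //; apply: generated_subgroupP.
apply/cyclic2P; exists h; split; last exact: sub_gh.
exact: (subgroupM (generated_subgroupP _) ch (sub_gh _ dg)).
Qed.

Lemma Cyc_inv c : Cyc G c -> Cyc G c^-1.
Proof.
move=> Cc y; have /cyclic2P[g [cg yg]] := Cc y.
apply/cyclic2P; exists g; split=> //.
exact: (subgroupV (generated_subgroupP _) cg).
Qed.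

(** The generators are absorbed one at a time into a common cyclic overgroup. *)
Lemma Cyc_setT_locally_cyclic : (forall x, Cyc G x) -> locally_cyclic G.
Proof.
move=> CG A /finite_seqP[s ->].
have [g gs] : exists g, [set` s] `<=` generated_subgroup [set g].
  elim: s => [|x s [g gs]]; first by exists 1.
  have /cyclic2P[h [xh gh]] := CG x g; exists h => z /=.
  rewrite inE => /orP[/eqP->//|zs].
  apply: (generated_subgroup_sub (generated_subgroupP [set h]) _ (gs _ zs)).
  by move=> _ ->.
apply: (subgroup_of_cyclic (generated_subgroupP _)) (_ : _ `<=` generated_subgroup [set g]).
by apply: generated_subgroup_sub => //; apply: generated_subgroupP.
Qed.

(** For [v] outside Cyc, the injection c |-> c v sends Cyc into its complement. *)
Lemma finite_compl_Cyc : ~ locally_cyclic G -> finite_set (~` Cyc G) ->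
  finite_set [set: G].
Proof.
move=> nlc finV.
have [v Cv] : exists v, ~ Cyc G v.
  by apply: contrapT => /forallNP nC; apply/nlc/Cyc_setT_locally_cyclic => x; apply: contrapT.
rewrite -(setvU (Cyc G)) finite_setU; split=> //.
apply: (sub_finite_set (B := (fun c => c * v) @^-1` (~` Cyc G))).
  move=> c Cc /= Ccv; apply: Cv; rewrite -(mulKg c v).
  by apply: Cyc_mul => //; apply: Cyc_inv.
apply: finite_preimage finV => a b _ _; exact: mulIg.
Qed.

End GeneratedSubgroups.

(** * Finite group structure on an enumerated group *)

Section FiniteAlias.

Variables (S : groupType) (s : seq S) (s_all : forall x, x \in s).

(* The argument is only there to let canonical structures find the enumeration
   of S. *)
Definition fin_alias of (forall x, x \in s) : Type := S.

Local Notation T := (fin_alias s_all).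

HB.instance Definition _ := Group.on T.

Lemma fin_alias_pickleK : pcancel (index^~ s : T -> nat) (onth s).
Proof.
by move=> x; rewrite onthE (nth_map x) ?index_mem ?s_all // nth_index ?s_all.
Qed.

HB.instance Definition _ := Choice_isCountable.Build T fin_alias_pickleK.

Lemma fin_alias_enumP : Finite.axiom (undup s : seq T).
Proof.
by apply: Finite.uniq_enumP (undup_uniq _) _ => x; rewrite mem_undup s_all.
Qed.

HB.instance Definition _ := isFinite.Build T fin_alias_enumP.

Definition fin_alias_group : finGroupType := T.

End FiniteAlias.

(** * Isomorphisms of abstract groups *)

Section GroupIsomorphisms.

Local Open Scope group_scope.

Lemma isomorphic_groups_of (S L : groupType) (f : S -> L) :
  {morph f : x y / x * y} -> bijective f -> isomorphic_groups S L.
Proof.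
move=> fM bij_f; pose fm := isMultiplicative.Build S L f fM.
pose F : {multiplicative S -> L} := HB.pack f fm; by exists F.
Qed.

Lemma isomorphic_groups_sym (S L : groupType) :
  isomorphic_groups S L -> isomorphic_groups L S.
Proof.
case=> f [g fK gK]; apply: (isomorphic_groups_of (f := g)); last by exists f.
by move=> x y; apply: (can_inj fK); rewrite gK gmulfM !gK.
Qed.

Lemma isomorphic_groups_trans (S L M : groupType) :
  isomorphic_groups S L -> isomorphic_groups L M -> isomorphic_groups S M.
Proof.
case=> f bij_f [g bij_g]; apply: (isomorphic_groups_of (f := g \o f)).
  by move=> x y /=; rewrite !gmulfM.
exact: bij_comp.
Qed.

Lemma isog_isomorphic_groups (S L : finGroupType) :
  [set: S] \isog [set: L] -> isomorphic_groups S L.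
Proof.
case/isogP=> f injf imf; apply: (isomorphic_groups_of (f := f)).
  by move=> x y; rewrite morphM ?inE.
apply: inj_card_bij; first by move=> x y; apply: (injmP injf); rewrite inE.
by rewrite -!cardsT -imf card_injm.
Qed.

Lemma finite_groupP (S : groupType) : finite_set [set: S]%classic ->
  exists F : finGroupType, isomorphic_groups S F.
Proof.
move=> /finite_seqP[s def_s].
have s_all x : x \in s by have : [set: S]%classic x by []; rewrite def_s.
exists (fin_alias_group s_all); apply: (isomorphic_groups_of (f := id)) => //.
by exists id.
Qed.

End GroupIsomorphisms.

(** * Non-cyclic graphs, and the link with the finite notions *)

Section NonCyclicGraphs.

Local Open Scope group_scope.
Local Open Scope classical_set_scope.

Definition gen_cyclic2 (G : groupType) (x y : G) :=
  is_cyclic (generated_subgroup [set x; y]).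

Lemma locally_cyclicP (G : groupType) :
  locally_cyclic G <-> forall x y : G, gen_cyclic2 x y.
Proof.
split=> [lcG x y|cG]; last exact: Cyc_setT_locally_cyclic.
by apply: lcG; apply: finite_set2.
Qed.

Lemma generated_subgroup_cycle (F : finGroupType) (g z : F) :
  generated_subgroup [set g] z <-> z \in <[g]>.
Proof.
split=> [/generated_subgroup1P[k [->|->]]|/cycleP[k ->]].
- exact: mem_cycle.
- by rewrite groupV mem_cycle.
- by apply/generated_subgroup1P; exists k; left.
Qed.

Lemma gen_cyclic2_cyc2 (F : finGroupType) (x y : F) :
  gen_cyclic2 x y <-> cyc2 x y.
Proof.
split=> [/cyclic2P[g [/generated_subgroup_cycle xg /generated_subgroup_cycle yg]]|].
  by apply/cyc2P; exists g.
by case/cyc2P=> g [xg yg]; apply/cyclic2P; exists g; split; apply/generated_subgroup_cycle.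
Qed.

Lemma Cyc_cyc_center (F : finGroupType) (x : F) : Cyc F x <-> x \in cyc_center F.
Proof.
split=> [Cx|/cyc_centerP Cx y]; last exact/gen_cyclic2_cyc2.
by apply/cyc_centerP=> y; apply/gen_cyclic2_cyc2/Cx.
Qed.

Lemma split_extremal_not_locally_cyclic p n (F : finGroupType) :
  prime p -> 2 < n -> split_extremal p n F -> ~ locally_cyclic F.
Proof.
move=> p_pr n_gt2 [x [y [gen oy]]] /locally_cyclicP cF.
have /negP[] := split_extremal_not_cyclic p_pr n_gt2 gen oy.
have := @pairwise_cyclic_gen F [set: F]%SET; rewrite genGid; apply=> u v _ _.
exact/gen_cyclic2_cyc2.
Qed.

Section CyclicityPreservingBijections.

Variables (S L : groupType) (f : S -> L) (g : L -> S).
Hypotheses (fK : cancel f g) (gK : cancel g f).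
Hypothesis cycf : forall x y, gen_cyclic2 (f x) (f y) <-> gen_cyclic2 x y.

Let Cycf x : Cyc L (f x) <-> Cyc S x.
Proof.
split=> Cx y; first by apply/cycf/Cx.
by rewrite -(gK y); apply/cycf/Cx.
Qed.

Let nCycf x : x \in ~` Cyc S -> f x \in ~` Cyc L.
Proof. by rewrite !inE => nCx /Cycf. Qed.

Let nCycg y : y \in ~` Cyc L -> g y \in ~` Cyc S.
Proof. by rewrite !inE => nCy Cgy; apply: nCy; rewrite -(gK y); apply/Cycf. Qed.

(** A bijection of the whole groups that respects cyclicity of pairs respects Cyc, and so restricts
    to the vertices. *)
Lemma isomorphic_graphs_of_bijection :
  isomorphic_graphs (noncyclic_graph S) (noncyclic_graph L).
Proof.
exists (fun u => exist _ (f (val u)) (nCycf (valP u))); split.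
  exists (fun v => exist _ (g (val v)) (nCycg (valP v))) => u; apply: val_inj => /=.
    exact: fK.
  exact: gK.
move=> u v; rewrite /= /noncyclic_adj /=.
have eqE : (exist (fun x => x \in ~` Cyc L) (f (val u)) (nCycf (valP u)) =
     exist (fun x => x \in ~` Cyc L) (f (val v)) (nCycf (valP v))) <-> u = v.
  by split=> [[/(can_inj fK)/val_inj]|->].
split=> -[ne nc]; split.
- by move=> e; apply/ne/eqE.
- by move=> c; apply/nc/cycf.
- by move/eqE.
- by move/cycf.
Qed.

Lemma locally_cyclic_bijection : locally_cyclic L -> locally_cyclic S.
Proof. by move/locally_cyclicP=> cL; apply/locally_cyclicP=> x y; apply/cycf. Qed.

End CyclicityPreservingBijections.

Lemma generated_subgroup_morph (S L : groupType) (f : {multiplicative S -> L}) (g z : S) :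
  generated_subgroup [set g] z -> generated_subgroup [set f g] (f z).
Proof.
have f1 : f 1 = 1 by apply: (@mulgI _ (f 1)); rewrite -gmulfM !mulg1.
have fX x k : f (x ^+ k) = f x ^+ k by elim: k => [|k IHk]; rewrite ?expgS ?gmulfM ?IHk.
have fV x : f x^-1 = (f x)^-1 by apply: (@mulgI _ (f x)); rewrite -gmulfM !mulgV.
move/generated_subgroup1P=> [k [->|->]]; apply/generated_subgroup1P; exists k.
  by left.
by right; rewrite fV fX.
Qed.

Lemma isomorphic_groups_bijection (S L : groupType) : isomorphic_groups S L ->
  exists (f : S -> L) (g : L -> S), [/\ cancel f g, cancel g f
    & forall x y, gen_cyclic2 (f x) (f y) <-> gen_cyclic2 x y].
Proof.
case=> f bij_f; have [g fK gK] := bij_f; exists f, g; split=> // x y.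
split=> /cyclic2P[h [xh yh]]; apply/cyclic2P; last first.
  by exists (f h); split; apply: generated_subgroup_morph.
exists (g h); have gM : {morph g : u v / u * v} by apply: can2_gmulfM fK gK.
pose gm := isMultiplicative.Build L S g gM.
pose G : {multiplicative L -> S} := HB.pack g gm.
by split; [rewrite -(fK x) | rewrite -(fK y)];
  apply: (generated_subgroup_morph (f := G)).
Qed.

Lemma isomorphic_graphs_sym X Y : isomorphic_graphs X Y -> isomorphic_graphs Y X.
Proof.
case=> f [[g fK gK] adjf]; exists g; split; first by exists f.
by move=> u v; rewrite -{2}(gK u) -{2}(gK v); apply: iff_sym.
Qed.

Lemma isomorphic_graphs_trans X Y Z :
  isomorphic_graphs X Y -> isomorphic_graphs Y Z -> isomorphic_graphs X Z.
Proof.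
case=> f [bf adjf] [g [bg adjg]]; exists (g \o f); split; first exact: bij_comp.
by move=> u v /=; apply: iff_trans (adjg _ _) (adjf _ _).
Qed.

Lemma isomorphic_noncyclic_graphs_isol (S S' L : groupType) :
  isomorphic_groups S S' -> isomorphic_noncyclic_graphs S L ->
  isomorphic_noncyclic_graphs S' L.
Proof.
move=> /isomorphic_groups_bijection[f [g [fK gK cycf]]] [nS nL iso].
split=> //; first by move/(locally_cyclic_bijection cycf).
apply: isomorphic_graphs_trans iso; apply: isomorphic_graphs_sym.
exact: isomorphic_graphs_of_bijection fK gK cycf.
Qed.

Lemma isomorphic_noncyclic_graphs_isor (S L L' : groupType) :
  isomorphic_groups L L' -> isomorphic_noncyclic_graphs S L ->
  isomorphic_noncyclic_graphs S L'.
Proof.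
move=> /isomorphic_groups_bijection[f [g [fK gK cycf]]] [nS nL iso].
split=> //; first by move/(locally_cyclic_bijection cycf).
apply: isomorphic_graphs_trans iso _.
exact: isomorphic_graphs_of_bijection fK gK cycf.
Qed.

Lemma isomorphic_graphs_cyc_equiv (S L : finGroupType) :
  isomorphic_graphs (noncyclic_graph S) (noncyclic_graph L) ->
  exists f : S -> L, cyc_equiv f.
Proof.
case=> phi [[psi phiK psiK] adjphi].
(* The value 1 on Cyc is a default: [cyc_equiv] constrains [f] only at vertices. *)
pose f u := if pselect (u \in ~` Cyc S) is left h then val (phi (exist _ u h)) else 1.
have fE (v : ~` Cyc S) : f (val v) = val (phi v).
  rewrite /f; case: pselect => [h|[]]; last exact: valP.
  by congr (val (phi _)); apply: val_inj.
have vert (F : finGroupType) (u : F) :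
    (u \in (~: cyc_center F)%SET) -> exists v : ~` Cyc F, u = val v.
  rewrite inE => /negP nCu; have h : u \in ~` Cyc F by rewrite inE => /Cyc_cyc_center.
  by exists (exist _ u h).
have vertK (F : finGroupType) (v : ~` Cyc F) : val v \in (~: cyc_center F)%SET.
  rewrite inE; apply/negP=> /Cyc_cyc_center; have := valP v; rewrite inE; exact.
exists f; split.
- move=> u v /vert[u' ->] /vert[v' ->]; rewrite !fE => /val_inj/(can_inj phiK)->//.
- apply/setP=> w; apply/imsetP/idP=> [[u /vert[u' ->] ->]|/vert[w' ->]].
    by rewrite fE vertK.
  by exists (val (psi w')); rewrite ?vertK // fE psiK.
move=> u v /vert[u' ->] /vert[v' ->]; rewrite !fE.
(* Adjacency concerns distinct vertices only; on the diagonal both sides are cyclic. *)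
have [->|ne] := pselect (u' = v'); first by rewrite !cyc2_refl.
have ne' : phi u' <> phi v' by move/(can_inj phiK).
have [adj1 adj2] := adjphi u' v'.
apply/idP/idP=> /gen_cyclic2_cyc2 c; apply/gen_cyclic2_cyc2; apply: contrapT => nc.
  by have [_] := adj2 (conj ne nc).
by have [_] := adj1 (conj ne' nc).
Qed.

End NonCyclicGraphs.

(** * Reduction of an arbitrary group to a finite split extremal one *)

Section Recognition.

Variables (p n : nat).
Hypotheses (p_pr : prime p) (n_gt2 : 2 < n).

Lemma noncyclic_graph_recognition (S : groupType) (L : finGroupType) :
  split_extremal p n L -> isomorphic_noncyclic_graphs S L ->
  exists F : finGroupType, [/\ isomorphic_groups S F, split_extremal p n F
    & num_cyclicizer2 F = num_cyclicizer2 L].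
Proof.
move=> sL isoSL; have [nS nL [phi [[psi phiK psiK] _]]] := isoSL.
have [F isoSF] : exists F : finGroupType, isomorphic_groups S F.
  apply/finite_groupP/finite_compl_Cyc => //.
  (* The inverse graph map, extended by 1, has a finite image that contains every vertex of [S]; so
     the complement of Cyc in [S] is finite. *)
  pose h (w : L) : S :=
    if pselect (w \in (~` Cyc L)%classic) is left hw
    then val (psi (exist _ w hw)) else 1%g.
  apply: (sub_finite_set (B := [set h w | w in [set: L]]%classic)).
    move=> u nCu; have hu : u \in (~` Cyc S)%classic by rewrite inE.
    exists (val (phi (exist _ u hu))) => //; rewrite /h.
    case: pselect => [hw|[]]; last exact: valP.
    rewrite (_ : exist (fun w : L => w \in (~` Cyc L)%classic) _ hw =
      phi (exist _ u hu)); last exact: val_inj.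
    by rewrite phiK.
  exact/finite_image/finite_finset.
exists F; have [_ _ isoFL] := isomorphic_noncyclic_graphs_isol isoSF isoSL.
have [f equiv_f] := isomorphic_graphs_cyc_equiv isoFL.
have [_ sF] := cyc_equiv_split_extremal p_pr n_gt2 sL equiv_f.
split=> //; apply: (cyc_equiv_card_cyclicizer_eq p_pr n_gt2 sL equiv_f).
apply: leq_ltn_trans (prime_gt1 p_pr) _.
by rewrite -[ltnLHS]expn1 (ltn_exp2l _ _ (prime_gt1 p_pr)) ltnW.
Qed.

End Recognition.

(** * Homomorphisms out of a presented group *)

Section WordEvaluation.

Local Open Scope group_scope.

Variables (I : choiceType) (rels : seq (word I * word I)).
Variables (L : groupType) (e : I -> L).

Definition eval_letter (l : I * bool) : L := if l.2 then (e l.1)^-1 else e l.1.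

Definition eval_word (w : word I) : L := \prod_(l <- w) eval_letter l.

Lemma eval_word_cat u v : eval_word (u ++ v) = eval_word u * eval_word v.
Proof. exact: big_cat. Qed.

Lemma eval_word_gen i : eval_word (word_gen i) = e i.
Proof. exact: big_seq1. Qed.

Lemma eval_word_exp w k : eval_word (word_exp w k) = eval_word w ^+ k.
Proof.
by elim: k => [|k IHk]; [apply: big_nil | rewrite expgS -IHk -eval_word_cat].
Qed.

Lemma eval_word_inv w : eval_word (word_inv w) = (eval_word w)^-1.
Proof.
elim: w => [|[i b] w IHw]; first by rewrite /eval_word big_nil invg1.
rewrite /word_inv /= rev_cons -cats1 eval_word_cat -/(word_inv w) IHw.
rewrite -[(i, b) :: w]cat1s eval_word_cat invgM; congr (_ * _).
by rewrite /eval_word !big_seq1 /eval_letter /=; case: b; rewrite /= ?invgK.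
Qed.

Hypothesis eval_rels : forall r, r \in rels -> eval_word r.1 = eval_word r.2.

Lemma eval_word_eq u v : word_eq rels u v -> eval_word u = eval_word v.
Proof.
elim=> //.
- by move=> u1 v1 w1 _ -> _.
- by move=> u1 u2 v1 v2 _ e1 _ e2; rewrite !eval_word_cat e1 e2.
move=> i b; rewrite /eval_word big_cons big_seq1 big_nil /eval_letter /=.
by case: b => /=; rewrite ?mulgV ?mulVg.
Qed.

Definition eval_pres (x : presented_group rels) : L :=
  eval_word (generic_quotient.repr x).

Lemma eval_presE w : eval_pres (pres rels w) = eval_word w.
Proof. by apply: eval_word_eq; apply/presP; rewrite pres_repr. Qed.

Lemma eval_presM : {morph eval_pres : x y / x * y}.
Proof.
move=> x y; rewrite -(pres_repr x) -(pres_repr y).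
by rewrite [pres rels _ * _]pres_mulE !eval_presE eval_word_cat.
Qed.

End WordEvaluation.

(** * Metacyclic presentations and their normal forms *)

Section MetacyclicPresentation.

Local Open Scope group_scope.

Variables (p q e : nat).
Hypotheses (p_gt0 : 0 < p) (q_gt0 : 0 < q).

Let a := word_gen false.
Let x := word_gen true.
Let rels : seq (word bool * word bool) :=
  [:: (word_exp x p, [::]); (word_exp a q, [::]); (word_conj a x, word_exp a e)].
Let A : presented_group rels := pres rels a.
Let X : presented_group rels := pres rels x.

Let presM u v : pres rels (u ++ v) = pres rels u * pres rels v.
Proof. by rewrite -pres_mulE. Qed.

Let presV u : pres rels (word_inv u) = (pres rels u)^-1.
Proof. by rewrite -pres_invE. Qed.

Let presX u k : pres rels (word_exp u k) = pres rels u ^+ k.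
Proof. by elim: k => [|k IHk] //; rewrite expgS -IHk -presM. Qed.

Let Xp : X ^+ p = 1.
Proof.
rewrite -presX; apply/presP/(word_eq_rel (r := (_, _))).
by rewrite /rels !inE eqxx.
Qed.

Let Aq : A ^+ q = 1.
Proof.
rewrite -presX; apply/presP/(word_eq_rel (r := (_, _))).
by rewrite /rels !inE eqxx orbT.
Qed.

Let AX : A * X = X * A ^+ e.
Proof.
suff <- : X^-1 * (A * X) = A ^+ e by rewrite mulVKg.
rewrite -presX -presV -(presM a x) -presM.
apply/presP/(word_eq_rel (r := (word_conj a x, word_exp a e))).
by rewrite /rels !inE eqxx !orbT.
Qed.

Let AXj i j : A ^+ i * X ^+ j = X ^+ j * A ^+ (i * e ^ j).
Proof.
have AiX k : A ^+ k * X = X * A ^+ (k * e).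
  elim: k => [|k IHk]; first by rewrite mulg1 mul1g.
  by rewrite expgS -mulgA IHk mulgA AX -mulgA -expgD mulSn.
elim: j i => [|j IHj] i; first by rewrite mulg1 mul1g muln1.
by rewrite expgS mulgA AiX -mulgA IHj mulgA -mulnA -expnS.
Qed.

(** As [p] and [q] are positive, inverse letters are positive powers; [AXj] then moves all powers of
    [X] to the left. *)
Lemma metacyclic_normal_form (u : presented_group rels) :
  exists ij : 'I_p * 'I_q, u = X ^+ ij.1 * A ^+ ij.2.
Proof.
suff [i [j ->]] : exists i j, u = X ^+ i * A ^+ j.
  exists (Ordinal (ltn_pmod i p_gt0), Ordinal (ltn_pmod j q_gt0)) => /=.
  have modX (z : presented_group rels) k m : z ^+ m = 1 -> z ^+ (k %% m) = z ^+ k.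
    by move=> zm; rewrite [in RHS](divn_eq k m) expgD mulnC expgM zm expg1n mul1g.
  by rewrite !modX.
rewrite -(pres_repr u); elim: (generic_quotient.repr u) => [|l w [i [j IHw]]].
  by exists 0%N, 0%N; rewrite mul1g.
rewrite -cat1s presM IHw.
have AV : A^-1 = A ^+ q.-1 by apply: (@mulgI _ A); rewrite -expgS prednK // Aq mulgV.
have XV : X^-1 = X ^+ p.-1 by apply: (@mulgI _ X); rewrite -expgS prednK // Xp mulgV.
have [k [|]] : exists k, pres rels [:: l] = A ^+ k \/ pres rels [:: l] = X ^+ k.
  case: l => -[] [].
  - by exists p.-1; right; rewrite -XV -presV.
  - by exists 1%N; right.
  - by exists q.-1; left; rewrite -AV -presV.
  - by exists 1%N; left.
- by move=> ->; exists i, (k * e ^ i + j)%N; rewrite mulgA AXj -mulgA expgD.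
- by move=> ->; exists (k + i)%N, j; rewrite mulgA expgD.
Qed.

(** Evaluation maps the [p * q] normal forms onto [L], which has as many elements. So it is
    injective on normal forms, and every element of the presented group has one. *)
Lemma metacyclic_presentation (L : finGroupType) (b y : L) :
  y ^+ p = 1 -> b ^+ q = 1 -> b ^ y = b ^+ e ->
  <[y]> * <[b]> = [set: L] -> #|L| = (p * q)%N ->
  isomorphic_groups (presented_group rels) L.
Proof.
move=> yp bq by_e defL oL.
pose ev (i : bool) := if i then y else b.
have ev_rels r : r \in rels -> eval_word ev r.1 = eval_word ev r.2.
  rewrite !inE => /or3P[] /eqP-> /=;
    rewrite ?eval_word_cat ?eval_word_exp ?eval_word_inv ?eval_word_gen
      ?yp ?bq //.
  - by rewrite /eval_word big_nil.
  - by rewrite /eval_word big_nil.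
apply: (isomorphic_groups_of (eval_presM ev_rels)).
pose h (ij : 'I_p * 'I_q) := X ^+ ij.1 * A ^+ ij.2.
have hev ij : eval_pres ev (h ij) = y ^+ ij.1 * b ^+ ij.2.
  by rewrite /h -!presX -presM eval_presE // eval_word_cat !eval_word_exp !eval_word_gen.
have surj g : exists ij, g = eval_pres ev (h ij).
  have: g \in <[y]> * <[b]> by rewrite defL inE.
  case/mulsgP=> _ _ /cycleP[i ->] /cycleP[j ->] ->.
  exists (Ordinal (ltn_pmod i p_gt0), Ordinal (ltn_pmod j q_gt0)).
  by rewrite hev /= !expg_mod.
have inj_ev_h : injective (eval_pres ev \o h).
  have im : (eval_pres ev \o h) @: [set: 'I_p * 'I_q] = [set: L].
    by apply/setP=> g; rewrite inE; have [ij ->] := surj g; apply: imset_f; rewrite inE.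
  have /imset_injP injh :
      #|(eval_pres ev \o h) @: [set: 'I_p * 'I_q]| == #|[set: 'I_p * 'I_q]|.
    by rewrite im !cardsT oL card_prod !card_ord.
  by move=> u v; apply: injh; rewrite inE.
have inj_ev : injective (eval_pres (rels := rels) ev).
  move=> u v; have [ij ->] := metacyclic_normal_form u.
  have [kl ->] := metacyclic_normal_form v.
  by move/inj_ev_h->.
have [pick pickE] := boolp.choice surj.
exists (h \o pick) => u; last by rewrite /= -pickE.
by apply: inj_ev; rewrite /= -pickE.
Qed.

End MetacyclicPresentation.

(** * The presented groups as modular and semidihedral groups *)

Section Presentations.

Local Open Scope group_scope.

Variables (p n : nat).
Hypotheses (p_pr : prime p) (n_gt2 : 2 < n).

Let def_n : n.-1.+1 = n. Proof. by case: (n) n_gt2. Qed.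

Lemma G_group_modular : isomorphic_groups (G_group p n) ('Mod_(p ^ n)%N)%type.
Proof.
have [[x y] gen /= [oy xy]] := generators_modular_group p_pr n_gt2 (isog_refl _).
have [oG _ ox _] := gen; have [_ _ _ defG nXY] := extremal_generators_facts p_pr gen.
apply: (@metacyclic_presentation _ _ _ _ _ _ x y).
- exact: prime_gt0.
- by rewrite expn_gt0 prime_gt0.
- by apply/eqP; rewrite -order_dvdn oy.
- by apply/eqP; rewrite -order_dvdn ox subn1.
- by rewrite xy subn2.
- by rewrite (normC nXY) defG.
- by rewrite -cardsT oG subn1 -expnS def_n.
Qed.

Lemma modular_split_extremal : split_extremal p n ('Mod_(p ^ n)%N)%type.
Proof.
have [[x y] gen /= [oy xy]] := generators_modular_group p_pr n_gt2 (isog_refl _).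
by exists x, y.
Qed.

Lemma dihedral_split_extremal : split_extremal 2 n ('D_(2 ^ n)%N)%type.
Proof.
have [[x y] gen /= [oy _]] := generators_2dihedral (ltnW n_gt2) (isog_refl _).
by exists x, y.
Qed.

Lemma H_group_semidihedral :
  3 < n -> isomorphic_groups (H_group n) ('SD_(2 ^ n)%N)%type.
Proof.
move=> n_gt3.
have [[x y] gen [oy xy]] := generators_semidihedral n_gt3 (isog_refl _).
have [oG _ ox _] := gen.
have [_ _ _ defG nXY] := extremal_generators_facts (isT : prime 2) gen.
apply: (@metacyclic_presentation _ _ _ _ _ _ x y) => //.
- by rewrite expn_gt0.
- by apply/eqP; rewrite -order_dvdn oy.
- by apply/eqP; rewrite -order_dvdn ox subn1.
- by rewrite xy subn2 subn1.
- by rewrite (normC nXY) defG.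
- by rewrite -cardsT oG subn1 -expnS def_n.
Qed.

Lemma semidihedral_split_extremal : 3 < n ->
  split_extremal 2 n ('SD_(2 ^ n)%N)%type.
Proof.
move=> n_gt3.
have [[x y] gen /= [oy _]] := generators_semidihedral n_gt3 (isog_refl _).
by exists x, y.
Qed.

Lemma modular_K_graph : 3 < n \/ 2 < p ->
  isomorphic_noncyclic_graphs ('Mod_(p ^ n)%N)%type (K_group p n).
Proof.
move=> n_p.
have [[x y] gen /= [oy xy]] := generators_modular_group p_pr n_gt2 (isog_refl _).
split.
- exact: split_extremal_not_locally_cyclic modular_split_extremal.
- exact: split_extremal_not_locally_cyclic (K_finGroup_split_extremal p_pr n_gt2).
apply: isomorphic_graphs_sym.
have [g fK gK] : bijective (modular_map x y : K_finGroup p n -> _).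
  apply: inj_card_bij; first exact: modular_map_inj gen oy.
  have [oG _ _ _] := gen.
  have [_ [_ [[oK _ _ _] _]]] := K_finGroup_split_extremal p_pr n_gt2.
  by rewrite -!cardsT oG oK.
apply: (isomorphic_graphs_of_bijection fK gK) => u v.
by rewrite !gen_cyclic2_cyc2 (modular_map_cyc2 p_pr n_gt2 n_p gen oy xy).
Qed.

Lemma isomorphic_noncyclic_graphs_num (S L : finGroupType) :
  split_extremal p n L -> isomorphic_noncyclic_graphs S L ->
  num_cyclicizer2 S = num_cyclicizer2 L.
Proof.
move=> sL [_ _ /isomorphic_graphs_cyc_equiv[f equiv_f]].
apply: (cyc_equiv_card_cyclicizer_eq p_pr n_gt2 sL equiv_f).
apply: leq_ltn_trans (prime_gt1 p_pr) _.
by rewrite -[ltnLHS]expn1 (ltn_exp2l _ _ (prime_gt1 p_pr)) ltnW.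
Qed.

Lemma K_group_graph_refl : isomorphic_noncyclic_graphs (K_group p n) (K_group p n).
Proof.
have nK := split_extremal_not_locally_cyclic p_pr n_gt2
  (K_finGroup_split_extremal p_pr n_gt2).
split; [exact: nK | exact: nK |].
by apply: (isomorphic_graphs_of_bijection (f := id) (g := id)).
Qed.

End Presentations.

(** * Separating the 2-groups by the number of involutions *)

Section TwoGroups.

Variables (n : nat) (F : finGroupType).
Hypotheses (n_gt2 : 2 < n) (sF : split_extremal 2 n F).

Lemma num_cyclicizer2_K :
  isomorphic_noncyclic_graphs F (K_group 2 n) -> num_cyclicizer2 F <= 2.
Proof.
have sK := @K_finGroup_split_extremal 2 n isT n_gt2.
move/(isomorphic_noncyclic_graphs_num (isT : prime 2) n_gt2 sK)=> ->.
have [x [y [gen oy]]] := sK.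
exact: num_cyclicizer2_abelian gen oy (K_finGroup_abelian 2 n).
Qed.

(** The modular group has the same graph as K, so the bound for K carries over. *)
Lemma num_cyclicizer2_abelian_or_modular :
  [set: F] \isog [set: K_finGroup 2 n] \/ 3 < n /\ [set: F] \isog 'Mod_(2 ^ n) ->
  num_cyclicizer2 F <= 2.
Proof.
move=> isoF; apply: num_cyclicizer2_K; case: isoF => [|[n_gt3]].
  move/isog_isomorphic_groups/isomorphic_groups_sym/isomorphic_noncyclic_graphs_isol.
  by apply; apply: K_group_graph_refl.
move/isog_isomorphic_groups/isomorphic_groups_sym/isomorphic_noncyclic_graphs_isol.
by apply; apply: modular_K_graph; rewrite ?n_gt3 //; left.
Qed.

Lemma num_cyclicizer2_isog_dihedral :
  [set: F] \isog 'D_(2 ^ n) -> num_cyclicizer2 F = 2 ^ n.-1.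
Proof.
by have [x [y [gen _]]] := sF; apply: num_cyclicizer2_dihedral gen.
Qed.

End TwoGroups.

(** * The five statements, by elimination in the classification *)

Theorem proposition8p5 (p n m : nat)
    (p_prime : prime p) (n_ge3 : 3 <= n) (m_ge4 : 4 <= m) :
  [/\ (* (1) *)
      forall S : groupType,
        isomorphic_noncyclic_graphs S (K_group 2 3) ->
        isomorphic_groups S (K_group 2 3),
      (* (2) *)
      3 < n \/ 2 < p ->
        isomorphic_noncyclic_graphs (G_group p n) (K_group p n),
      (* (3) *)
      forall S : groupType,
        isomorphic_noncyclic_graphs S (H_group m) ->
        isomorphic_groups S (H_group m),
      (* (4) *)
      forall S : groupType,
        isomorphic_noncyclic_graphs S (D_group n) ->
        isomorphic_groups S (D_group n)
    & (* (5), under the assumption of (2): for p = 2 and n = 3, G_group p n is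
         the dihedral group of order 8 and (5) would contradict (1) *)
      3 < n \/ 2 < p ->
        forall S : groupType,
          isomorphic_noncyclic_graphs S (K_group p n) <->
          isomorphic_groups S (G_group p n) \/
          isomorphic_groups S (K_group p n)].
Proof.
have four_le k : 1 < k -> 4 <= 2 ^ k by move=> k_gt1; rewrite -[4]/(2 ^ 2) leq_exp2l.
have sK8 := @K_finGroup_split_extremal 2 3 isT isT.
split.
- move=> S /(@noncyclic_graph_recognition 2 3 isT isT S _ sK8).
  case=> F [isoSF sF numF]; apply: (isomorphic_groups_trans isoSF).
  case: (split_extremal_class (isT : prime 2) (isT : 2 < 3) sF).
  + exact: isog_isomorphic_groups.
  + by case.
  (* The dihedral group of order 8 has four involutions outside [<[x]>], against at most two for
     K(8). *)
  + case=> _ /(num_cyclicizer2_isog_dihedral (isT : 2 < 3) sF); rewrite numF => num4.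
    have K8K8 := K_group_graph_refl (isT : prime 2) (isT : 2 < 3).
    have := @num_cyclicizer2_K 3 (K_finGroup 2 3) isT K8K8.
    by rewrite num4.
  + by case.
- move=> n_p; have := modular_K_graph p_prime n_ge3 n_p.
  apply: isomorphic_noncyclic_graphs_isol.
  exact/isomorphic_groups_sym/G_group_modular.
- move=> S; have m_gt2 := ltnW m_ge4.
  move/(isomorphic_noncyclic_graphs_isor (H_group_semidihedral m_gt2 m_ge4)).
  have sSD := semidihedral_split_extremal m_ge4.
  move/(noncyclic_graph_recognition (isT : prime 2) m_gt2 sSD) => [F [isoSF sF]].
  rewrite (num_cyclicizer2_semidihedral m_ge4 (isog_refl _)) => numF.
  have m2 : 4 <= 2 ^ m.-2 by apply: four_le; case: (m) m_ge4 => [|[|[|]]].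
  have le2 := num_cyclicizer2_abelian_or_modular m_gt2.
  apply: (isomorphic_groups_trans isoSF).
  case: (split_extremal_class (isT : prime 2) m_gt2 sF).
  + by move=> isoK; have := le2 _ (or_introl isoK); rewrite numF leqNgt ltnW.
  + by move=> isoM; have := le2 _ (or_intror isoM); rewrite numF leqNgt ltnW.
  (* The dihedral count 2^(m-1) differs from the semidihedral count 2^(m-2). *)
  + case=> _ /(num_cyclicizer2_isog_dihedral m_gt2 sF); rewrite numF => /eqP.
    by rewrite eqn_exp2l //; case: (m) m_ge4 => [|[|k]] //= _; rewrite ltn_eqF.
  + case=> _ _ /isog_isomorphic_groups isoFSD; apply: isomorphic_groups_trans isoFSD _.
    exact/isomorphic_groups_sym/H_group_semidihedral.
- move=> S; have sD := dihedral_split_extremal n_ge3.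
  move/(@noncyclic_graph_recognition 2 n isT n_ge3 S _ sD).
  case=> F [isoSF sF].
  rewrite (num_cyclicizer2_isog_dihedral n_ge3 sD (isog_refl _)) => numF.
  have n2 : 4 <= 2 ^ n.-1 by apply: four_le; case: (n) n_ge3 => [|[|]].
  have le2 := num_cyclicizer2_abelian_or_modular n_ge3.
  apply: (isomorphic_groups_trans isoSF).
  case: (split_extremal_class (isT : prime 2) n_ge3 sF).
  + by move=> isoK; have := le2 _ (or_introl isoK); rewrite numF leqNgt ltnW.
  + by move=> isoM; have := le2 _ (or_intror isoM); rewrite numF leqNgt ltnW.
  + by case=> _; apply: isog_isomorphic_groups.
  + case=> _ n_gt3 /(num_cyclicizer2_semidihedral n_gt3); rewrite numF => /eqP.
    by rewrite eqn_exp2l //; case: (n) n_ge3 => [|[|k]] //= _; rewrite gtn_eqF.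
move=> n_p S; split; last first.
  case=> /isomorphic_groups_sym isoS; apply: isomorphic_noncyclic_graphs_isol isoS _.
    apply: isomorphic_noncyclic_graphs_isol (modular_K_graph p_prime n_ge3 n_p).
    exact/isomorphic_groups_sym/G_group_modular.
  exact: K_group_graph_refl.
have sK := K_finGroup_split_extremal p_prime n_ge3.
move/(noncyclic_graph_recognition p_prime n_ge3 sK) => [F [isoSF sF numF]].
(* This bound excludes D and SD, whose counts are at least 4 in the present range. *)
have num2 : p = 2 -> num_cyclicizer2 F <= 2.
  move=> p2; rewrite numF p2; apply: (num_cyclicizer2_K n_ge3).
  exact: K_group_graph_refl.
case: (split_extremal_class p_prime n_ge3 sF).
- by move/isog_isomorphic_groups/(isomorphic_groups_trans isoSF); right.
- case=> _ /isog_isomorphic_groups/(isomorphic_groups_trans isoSF) isoM; left.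
  exact/(isomorphic_groups_trans isoM)/isomorphic_groups_sym/G_group_modular.
- case=> p2; rewrite p2 in sF; move/(num_cyclicizer2_isog_dihedral n_ge3 sF) => numD.
  have := num2 p2; rewrite numD leqNgt ltnW //.
  by apply: four_le; case: (n) n_ge3 => [|[|]].
case=> p2 n_gt3 /(num_cyclicizer2_semidihedral n_gt3) numD.
have := num2 p2; rewrite numD leqNgt ltnW //.
by apply: four_le; case: (n) n_gt3 => [|[|[|]]].
Qed.
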